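(* For fixed $d \ge 1$, as $n \to \infty$ the expected number $\mathcal{I}_{d,n}$ of interior generators after $n$ observations in dimension $d$ satisfies $$\mathcal{I}_{d,n} = (\ln n)^{d-1} \sum_{j=0}^{d-1} \frac{(-1)^j \Gamma^{(j)}(d)}{j!\,(d-1-j)!} (\ln n)^{-j} + O\big(n^{-1}(\ln n)^{d-1}\big),$$ where $\Gamma^{(j)}$ denotes the $j$-th derivative of the Gamma function.
   Context: Let $X^{(1)}, X^{(2)}, \dots$ be i.i.d. random vectors uniformly distributed on $[0,1)^d$. For $x,y\in\mathbb{R}^d$, $x \prec y$ means $x_j<y_j$ for all $j$ and $x \le y$ means $x_j \le y_j$ for all $j$. After $n$ observations, the record-setting region is $S_n := \{x \in [0,1)^d : x \not\prec X^{(i)} \text{ for all } i \in [n]\}$; its generators are the minimal elements of $S_n$ with respect to $\le$; a generator is interior if all its coordinates are nonzero. $\mathcal{I}_{d,n}$ is the expected number of interior generators of $S_n$. *)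

(* Defs.v *)
From Stdlib Require Import Reals Lra List Classical ClassicalEpsilon.
Open Scope R_scope.

Definition finite_card {A : Type} (P : A -> Prop) : nat :=
  match excluded_middle_informative
          (exists l : list A, NoDup l /\ forall x, In x l <-> P x) with
  | left H => length (proj1_sig (constructive_indefinite_description _ H))
  | right _ => O
  end.

(* A sample of n observations in dimension d is encoded as w : nat -> R,
   with X^(i)_j = w (i*d + j) for i < n, j < d (indices from 0).
   Points of R^d are lists of reals of length d; coordinate j is nth j x 0. *)
Definition obs (d : nat) (w : nat -> R) (i j : nat) : R := w (i * d + j)%nat.

Definition coord (x : list R) (j : nat) : R := nth j x 0.

Definition in_S (d n : nat) (w : nat -> R) (x : list R) : Prop :=
  length x = d /\
  (forall j, (j < d)%nat -> 0 <= coord x j < 1) /\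
  (forall i, (i < n)%nat -> ~ (forall j, (j < d)%nat -> coord x j < obs d w i j)).

Definition le_pt (d : nat) (x y : list R) : Prop :=
  forall j, (j < d)%nat -> coord x j <= coord y j.

Definition is_generator (d n : nat) (w : nat -> R) (x : list R) : Prop :=
  in_S d n w x /\ (forall y, in_S d n w y -> le_pt d y x -> y = x).

Definition is_interior (d : nat) (x : list R) : Prop :=
  forall j, (j < d)%nat -> coord x j <> 0.

Definition num_interior_generators (d n : nat) (w : nat -> R) : R :=
  INR (finite_card (fun x => is_generator d n w x /\ is_interior d x)).

(* ---------- Integration (expectation under the uniform law) ---------- *)
Definition is_RInt (f : R -> R) (a b v : R) : Prop :=
  exists pr : Riemann_integrable f a b, RiemannInt pr = v.

Definition cons_fun (t : R) (w : nat -> R) : nat -> R :=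
  fun k => match k with O => t | S k' => w k' end.

Fixpoint MInt (m : nat) (F : (nat -> R) -> R) (v : R) : Prop :=
  match m with
  | O => v = F (fun _ => 0)
  | S m' => exists G : R -> R,
      (forall t, 0 <= t <= 1 -> MInt m' (fun w => F (cons_fun t w)) (G t)) /\
      is_RInt G 0 1 v
  end.

Definition improper_int_0_inf (f : R -> R) (v : R) : Prop :=
  forall eps, eps > 0 -> exists delta M, delta > 0 /\
    forall a b, 0 < a < delta -> b > M ->
      exists pr : Riemann_integrable f a b, Rabs (RiemannInt pr - v) < eps.

Definition is_Gamma (x v : R) : Prop :=
  improper_int_0_inf (fun t => Rpower t (x - 1) * exp (- t)) v.

Definition are_derivs_on_pos (Gam : R -> R) (D : nat -> R -> R) : Prop :=
  (forall x, 0 < x -> D O x = Gam x) /\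
  (forall j x, 0 < x -> derivable_pt_lim (D j) x (D (S j) x)).

(* Main.v *)
(** In every coordinate [j] an interior generator [x] agrees with an observation that
    exceeds [x] in all other coordinates; so almost surely the interior generators
    correspond to injective [d]-tuples of observations subject to order conditions.  Putting [y_k = 1 - x_k], the expectation is
    [n (n-1) ... (n-d+1) * int_{[0,1]^d} (prod y)^(d-1) (1 - prod y)^(n-d) dy], and [- ln (prod y)]
    is Gamma(d)-distributed.  With [prod y = e^v / n] this becomes
    [1/(d-1)! * int (ln n - v)^(d-1) e^(d v) rho (1 - e^v/n)^(n-d) dv] over [v <= ln n], where
    [rho = n (n-1) ... (n-d+1) / n^d].  Replacing [rho (1 - e^v/n)^(n-d)] by [exp (- e^v)] costs a relative
    error [O((1 + e^v)^2 / n)], and the resulting integral is expanded by the binomial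
    theorem into the moments [int v^j e^(d v - e^v) dv], which are the derivatives of Gamma
    at [d].

    The iterated Riemann integral is reached through averages over the grid of midpoints
    [(k + 1/2) / N]: a bounded function of the weak order of its arguments has an iterated
    integral, which its grid averages approximate at rate [O(1/N)].  Grid averages are
    finite sums, so independence and exchange of the variables become counting. *)
Require Import Defs.
From Stdlib Require Import Reals Arith Factorial Lra Lia List.
From Stdlib Require Import ClassicalEpsilon FunctionalExtensionality Permutation.
From Coquelicot Require Import Coquelicot.
From mathcomp Require all_boot.
Open Scope R_scope.

(** * Iterated integrals of order-invariant functions *)

(** [MInt] asks for Riemann integrability of every inner integral at every value of the outer
    variables, ties and endpoints included, so null sets cannot be discarded along the way. Instead
    each value fixed by an outer integral is carried along as a reference point at which the
    remaining integrand may jump, and the bounds are uniform in those values. On the grid the count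
    is exact except for samples with ties, whose proportion is O(1/N). As N grows this gives, for n
    >= d, the closed form [falling n d] times the sum over i of (-1)^i C(n-d, i) / (d+i)^d. Such an
    alternating sum hides its size, so each 1/(d+i)^d is rewritten as an integral over a half line
    and the integrands are folded back into one power. The change of variables in the cube is
    therefore never carried out. The factor (ln n)^(d-1) of the error comes from |ln n - v| <= ln n
    (1 + |v|), used against a majorant that does not depend on n. *)

Definition ind (P : Prop) : R := if excluded_middle_informative P then 1 else 0.

Lemma ind_true (P : Prop) : P -> ind P = 1.
Proof. unfold ind; destruct (excluded_middle_informative P); tauto. Qed.

Lemma ind_false (P : Prop) : ~ P -> ind P = 0.
Proof. unfold ind; destruct (excluded_middle_informative P); tauto. Qed.

Lemma ind_ge0 (P : Prop) : 0 <= ind P.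
Proof. unfold ind; destruct (excluded_middle_informative P); lra. Qed.

Lemma ind_iff (P Q : Prop) : (P <-> Q) -> ind P = ind Q.
Proof.
intros h; destruct (classic P) as [hP | hP].
- rewrite !ind_true; tauto.
- rewrite !ind_false; tauto.
Qed.

Fixpoint rsum (n : nat) (f : nat -> R) : R :=
  match n with O => 0 | S n' => rsum n' f + f n' end.

Lemma rsum_ext n f g : (forall k, (k < n)%nat -> f k = g k) -> rsum n f = rsum n g.
Proof.
induction n as [|n IH]; intros h; simpl; [reflexivity|].
rewrite IH, h; auto with arith.
Qed.

Lemma rsum_le n f g : (forall k, (k < n)%nat -> f k <= g k) -> rsum n f <= rsum n g.
Proof.
induction n as [|n IH]; intros h; simpl; [lra|].
apply Rplus_le_compat; auto with arith.
Qed.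

Lemma rsum_ge0 n f : (forall k, (k < n)%nat -> 0 <= f k) -> 0 <= rsum n f.
Proof.
induction n as [|n IH]; intros h; simpl; [lra|].
apply Rplus_le_le_0_compat; auto with arith.
Qed.

Lemma rsum_plus n f g : rsum n (fun k => f k + g k) = rsum n f + rsum n g.
Proof. induction n as [|n IH]; simpl; [|rewrite IH]; ring. Qed.

Lemma rsum_minus n f g : rsum n (fun k => f k - g k) = rsum n f - rsum n g.
Proof. induction n as [|n IH]; simpl; [|rewrite IH]; ring. Qed.

Lemma rsum_scal n c f : rsum n (fun k => c * f k) = c * rsum n f.
Proof. induction n as [|n IH]; simpl; [|rewrite IH]; ring. Qed.

Lemma rsum_const n c : rsum n (fun _ => c) = INR n * c.
Proof. induction n as [|n IH]; [simpl; ring|]. rewrite S_INR; simpl; rewrite IH; ring. Qed.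

Lemma rsum_abs n f : Rabs (rsum n f) <= rsum n (fun k => Rabs (f k)).
Proof.
induction n as [|n IH]; simpl; [rewrite Rabs_R0; lra|].
eapply Rle_trans; [apply Rabs_triang|lra].
Qed.

Lemma rsum_shift n f : rsum (S n) f = f 0%nat + rsum n (fun k => f (S k)).
Proof. induction n as [|n IH]; [simpl; ring|]. simpl in *. rewrite IH. ring. Qed.

Lemma count_interval N a b : a <= b ->
  rsum N (fun k => ind (a <= INR k <= b)) <= b - a + 1.
Proof.
intros hab.
(* The induction needs a bound that sees [N]: the integers counted lie in [a, min(b, N - 1)]. *)
apply Rle_trans with (Rmax 0 (Rmin b (INR N - 1) - a + 1)).
2:{ unfold Rmax, Rmin; destruct Rle_dec; destruct Rle_dec; lra. }
induction N as [|N IH].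
- simpl; apply Rmax_l.
- rewrite S_INR; cbn [rsum].
  destruct (classic (a <= INR N <= b)) as [h|h].
  + rewrite (ind_true _ h).
    revert IH; unfold Rmax, Rmin; repeat destruct Rle_dec; lra.
  + rewrite (ind_false _ h).
    revert IH; unfold Rmax, Rmin; repeat destruct Rle_dec; lra.
Qed.

(** Midpoints, unlike left endpoints, lie strictly between 0 and 1, so a generator named by grid
    points meets the boundary conditions for free. *)
Definition gpt (N k : nat) : R := (INR k + / 2) / INR N.

(** The recursion copies that of [MInt], base case included, so that integral and average are
    compared one variable at a time. *)
Fixpoint gsum (N m : nat) (F : (nat -> R) -> R) : R :=
  match m with
  | O => F (fun _ => 0)
  | S m' => / INR N * rsum N (fun k => gsum N m' (fun w => F (cons_fun (gpt N k) w)))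
  end.

Definition hits (a b : R) (m : nat) (w : nat -> R) : R :=
  rsum m (fun i => ind (a <= w i <= b)).

Lemma hits_cons a b m t w :
  hits a b (S m) (cons_fun t w) = ind (a <= t <= b) + hits a b m w.
Proof. unfold hits; rewrite rsum_shift; reflexivity. Qed.

Lemma hits_ge1 a b m w i : (i < m)%nat -> a <= w i <= b -> 1 <= hits a b m w.
Proof.
unfold hits; intros hi h.
induction m as [|m IH]; [lia|]. simpl.
destruct (Nat.eq_dec i m) as [->|hne].
- rewrite (ind_true _ h).
  assert (0 <= rsum m (fun i => ind (a <= w i <= b))) by (apply rsum_ge0; intros; apply ind_ge0).
  lra.
- pose proof (ind_ge0 (a <= w m <= b)).
  assert (1 <= rsum m (fun i => ind (a <= w i <= b))) by (apply IH; lia). lra.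
Qed.

Lemma INR_gt0 N : (0 < N)%nat -> 0 < INR N.
Proof. apply lt_0_INR. Qed.

Lemma grid_count N a b : (0 < N)%nat -> a <= b ->
  / INR N * rsum N (fun k => ind (a <= gpt N k <= b)) <= b - a + / INR N.
Proof.
intros hN hab; pose proof (INR_gt0 N hN) as h.
assert (hc : rsum N (fun k => ind (a <= gpt N k <= b)) <= (INR N * b - / 2) - (INR N * a - / 2) + 1).
{ rewrite (rsum_ext N _ (fun k => ind (INR N * a - / 2 <= INR k <= INR N * b - / 2))).
  - apply count_interval. assert (INR N * a <= INR N * b) by (apply Rmult_le_compat_l; lra). lra.
  - intros k _; apply ind_iff. unfold gpt.
    rewrite <- Rle_div_r, Rle_div_l by lra. lra. }
apply (Rmult_le_compat_l (/ INR N)) in hc; [|left; apply Rinv_0_lt_compat; lra].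
eapply Rle_trans; [exact hc|]. right; field; lra.
Qed.

(** A union bound. [hits] counts coordinates instead of testing for one, hence is additive: once the
    first coordinate is frozen, its own hit joins the constant [c] and the induction continues with
    the others. *)
Lemma gsum_close N m : (0 < N)%nat -> forall F F' c K a b, 0 <= K -> a <= b ->
  (forall w, Rabs (F w - F' w) <= c + K * hits a b m w) ->
  Rabs (gsum N m F - gsum N m F') <= c + K * INR m * (b - a + / INR N).
Proof.
intros hN; pose proof (INR_gt0 N hN) as hp.
induction m as [|m IH]; intros F F' c K a b hK hab hF.
- simpl. specialize (hF (fun _ => 0)). unfold hits in hF; simpl in hF. lra.
- cbn [gsum].
  set (q := b - a + / INR N) in *.
  assert (hk : forall k, (k < N)%nat ->
    Rabs (gsum N m (fun w => F (cons_fun (gpt N k) w)) - gsum N m (fun w => F' (cons_fun (gpt N k) w)))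
    <= (c + K * INR m * q) + K * ind (a <= gpt N k <= b)).
  { intros k _.
    eapply Rle_trans; [apply (IH _ _ (c + K * ind (a <= gpt N k <= b)) K a b hK hab)|fold q; lra].
    intros w; eapply Rle_trans; [apply hF|]. rewrite hits_cons; lra. }
  rewrite <- Rmult_minus_distr_l, Rabs_mult, <- rsum_minus.
  rewrite Rabs_pos_eq by (left; apply Rinv_0_lt_compat; lra).
  apply Rle_trans with (/ INR N * rsum N (fun k => (c + K * INR m * q) + K * ind (a <= gpt N k <= b))).
  + apply Rmult_le_compat_l; [left; apply Rinv_0_lt_compat; lra|].
    eapply Rle_trans; [apply rsum_abs|]. apply rsum_le; exact hk.
  + rewrite rsum_plus, rsum_const, rsum_scal, S_INR.
    pose proof (grid_count N a b hN hab) as hg; fold q in hg.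
    apply (Rmult_le_compat_l K) in hg; [|exact hK].
    replace (/ INR N * (INR N * (c + K * INR m * q) + K * rsum N (fun k => ind (a <= gpt N k <= b))))
      with (c + K * INR m * q + K * (/ INR N * rsum N (fun k => ind (a <= gpt N k <= b)))) by (field; lra).
    lra.
Qed.

Lemma gsum_zero N m : gsum N m (fun _ => 0) = 0.
Proof.
induction m as [|m IH]; simpl; [reflexivity|].
rewrite IH, rsum_const; ring.
Qed.

Lemma gsum_bound N m F B : (0 < N)%nat -> (forall w, Rabs (F w) <= B) -> Rabs (gsum N m F) <= B.
Proof.
intros hN hF.
pose proof (gsum_close N m hN F (fun _ => 0) B 0 0 0 (Rle_refl _) (Rle_refl _)) as h.
rewrite gsum_zero, Rminus_0_r in h.
eapply Rle_trans; [apply h|lra].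
intros w; rewrite Rminus_0_r; specialize (hF w); lra.
Qed.

(** Jumps are confined to [E]. The ends [a] and [b] are excluded so that an interval can be cut at a
    point of [E] whatever the value of [G] there. *)
Definition lip_off (E : list R) (L a b : R) (G : R -> R) : Prop :=
  forall t t', a < t -> t < t' -> t' < b -> (forall e, In e E -> e < t \/ t' < e) ->
  Rabs (G t - G t') <= L * (t' - t).

(* McShane: [x |-> sup_y (G y - L |x - y|)] extends [G] to a Lipschitz function on the line. *)
Lemma lip_extension L a b G : 0 <= L -> a < b -> lip_off nil L a b G ->
  exists H, (forall x, a < x < b -> H x = G x) /\ (forall x y, Rabs (H x - H y) <= L * Rabs (x - y)).
Proof.
intros hL hab hG.
assert (hG' : forall x y, a < x < b -> a < y < b -> Rabs (G x - G y) <= L * Rabs (x - y)).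
{ intros x y hx hy; destruct (Rtotal_order x y) as [h|[->|h]].
  - rewrite (Rabs_left (x - y)) by lra. eapply Rle_trans; [apply hG; try lra; intros e []|lra].
  - rewrite !Rminus_diag, Rabs_R0; lra.
  - rewrite (Rabs_right (x - y)) by lra. rewrite Rabs_minus_sym. apply hG; try lra; intros e []. }
assert (hsup : forall x, exists s, is_lub (fun z => exists y, a < y < b /\ z = G y - L * Rabs (x - y)) s).
{ intros x. set (c := (a + b) / 2). assert (hc : a < c < b) by (unfold c; lra).
  destruct (completeness (fun z => exists y, a < y < b /\ z = G y - L * Rabs (x - y))) as [s hs].
  - exists (G c + L * Rabs (x - c)). intros z [y [hy ->]].
    pose proof (hG' y c hy hc) as h1. apply Rabs_le_between in h1.
    assert (Rabs (y - c) <= Rabs (x - y) + Rabs (x - c)).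
    { replace (y - c) with (- (x - y) + (x - c)) by ring.
      eapply Rle_trans; [apply Rabs_triang|]. rewrite Rabs_Ropp; lra. }
    assert (L * Rabs (y - c) <= L * (Rabs (x - y) + Rabs (x - c))) by (apply Rmult_le_compat_l; lra).
    lra.
  - exists (G c - L * Rabs (x - c)); exists c; auto.
  - exists s; exact hs. }
destruct (choice _ hsup) as [H hH]. exists H. split.
- intros x hx. destruct (hH x) as [h1 h2]. apply Rle_antisym.
  + apply h2. intros z [y [hy ->]]. pose proof (hG' y x hy hx) as h.
    rewrite (Rabs_minus_sym y x) in h. apply Rabs_le_between in h. lra.
  + apply h1. exists x; split; [exact hx|]. rewrite Rminus_diag, Rabs_R0; lra.
- assert (hone : forall x y, H x <= H y + L * Rabs (x - y)).
  { intros x y. apply (proj2 (hH x)). intros z [u [hu ->]].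
    assert (G u - L * Rabs (y - u) <= H y) by (apply (proj1 (hH y)); exists u; auto).
    assert (Rabs (y - u) <= Rabs (x - u) + Rabs (x - y)).
    { replace (y - u) with ((x - u) + - (x - y)) by ring.
      eapply Rle_trans; [apply Rabs_triang|]. rewrite Rabs_Ropp; lra. }
    assert (L * Rabs (y - u) <= L * (Rabs (x - u) + Rabs (x - y))) by (apply Rmult_le_compat_l; lra).
    lra. }
  intros x y; apply Rabs_le; split.
  + pose proof (hone y x) as h; rewrite Rabs_minus_sym in h; lra.
  + pose proof (hone x y); lra.
Qed.

Lemma lip_continuous L H x : 0 <= L -> (forall x y, Rabs (H x - H y) <= L * Rabs (x - y)) ->
  continuous H x.
Proof.
intros hL hH. apply continuity_pt_filterlim. intros eps heps.
exists (eps / (L + 1)); split; [apply Rdiv_lt_0_compat; lra|].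
intros y [_ hy]. simpl in *; unfold R_dist in *.
eapply Rle_lt_trans; [apply hH|].
apply Rle_lt_trans with (L * (eps / (L + 1))).
- apply Rmult_le_compat_l; lra.
- apply Rminus_lt_0. replace (eps - L * (eps / (L + 1))) with (eps / (L + 1)) by (field; lra).
  apply Rdiv_lt_0_compat; lra.
Qed.

(** After cutting at the points of [E], each open piece carries a function with a continuous
    extension, and values at the ends do not affect Riemann integrability. *)
Lemma lip_off_integrable E L G : 0 <= L -> forall a b, a <= b -> lip_off E L a b G -> ex_RInt G a b.
Proof.
intros hL; induction E as [|e E IH]; intros a b hab hG.
- destruct hab as [hab| ->]; [|apply ex_RInt_point].
  destruct (lip_extension L a b G hL hab hG) as [H [hHG hH]].
  apply ex_RInt_ext with H.
  + intros x; rewrite Rmin_left, Rmax_right by lra; apply hHG.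
  + apply @ex_RInt_continuous; intros z _; exact (lip_continuous L H z hL hH).
- destruct (classic (a < e < b)) as [he|he].
  + apply ex_RInt_Chasles with e; apply IH; try lra; intros t t' h1 h2 h3 h; apply hG; try lra;
      intros e' [<-|he']; auto; lra.
  + apply IH; [exact hab|]. intros t t' h1 h2 h3 h; apply hG; try lra; intros e' [<-|he']; auto; lra.
Qed.

Definition lsum (E : list R) (f : R -> R) : R := fold_right (fun e s => f e + s) 0 E.

Lemma lsum_ge0 E f : (forall e, 0 <= f e) -> 0 <= lsum E f.
Proof. intros h; induction E as [|e E IH]; simpl; [lra|]. specialize (h e); lra. Qed.

Lemma lsum_ge E f e : (forall e, 0 <= f e) -> In e E -> f e <= lsum E f.
Proof.
intros h; induction E as [|e' E IH]; simpl; [tauto|].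
pose proof (lsum_ge0 E f h). intros [-> | hi]; [lra|]. specialize (IH hi). specialize (h e'). lra.
Qed.

(** A cell of length 1/N free of [E] contributes at most L/N^2, and there are N cells. A cell
    touched by [E] contributes at most 2B/N, and each point of [E] touches at most two closed cells,
    whence 4B. *)
Lemma midpoint_error E L B G N : 0 <= L -> 0 <= B -> (0 < N)%nat ->
  (forall t, Rabs (G t) <= B) -> (forall a b, lip_off E L a b G) ->
  Rabs (RInt G 0 1 - / INR N * rsum N (fun k => G (gpt N k)))
  <= (L + 4 * B * INR (length E)) / INR N.
Proof.
intros hL hB hN hGB hG.
pose proof (INR_gt0 N hN) as hp.
pose proof (Rinv_0_lt_compat _ hp) as hip.
assert (hex : forall a b, a <= b -> ex_RInt G a b).
{ intros a b hab; apply (lip_off_integrable E L G hL a b hab (hG a b)). }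
set (err := fun k : nat => / INR N * (L / INR N + 2 * B * lsum E (fun e => ind (INR N * e - 1 <= INR k <= INR N * e)))).
assert (hpt : forall k t, INR k / INR N < t < INR (S k) / INR N ->
  Rabs (G t - G (gpt N k)) <= L / INR N + 2 * B * lsum E (fun e => ind (INR N * e - 1 <= INR k <= INR N * e))).
{ intros k t [h1 h2].
  rewrite S_INR in h2. rewrite <- Rlt_div_r in h2 by lra. rewrite Rlt_div_l in h1 by lra.
  assert (hm1 : INR k < gpt N k * INR N < INR k + 1).
  { unfold gpt. replace ((INR k + / 2) / INR N * INR N) with (INR k + / 2) by (field; lra). lra. }
  set (s := gpt N k) in *.
  assert (hLN : 0 <= L / INR N) by (apply Rmult_le_pos; lra).
  assert (h0 : forall e, 0 <= ind (INR N * e - 1 <= INR k <= INR N * e)) by (intros; apply ind_ge0).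
  destruct (classic (exists e, In e E /\ INR N * e - 1 <= INR k <= INR N * e)) as [[e [he hke]]|hno].
  - pose proof (lsum_ge E _ e h0 he) as hl. simpl in hl. rewrite (ind_true _ hke) in hl.
    pose proof (hGB t) as g1; pose proof (hGB s) as g2.
    apply Rabs_le_between in g1; apply Rabs_le_between in g2.
    assert (2 * B * 1 <= 2 * B * lsum E (fun e => ind (INR N * e - 1 <= INR k <= INR N * e)))
      by (apply Rmult_le_compat_l; lra).
    apply Rabs_le; lra.
  - pose proof (lsum_ge0 E _ h0) as hl.
    assert (0 <= 2 * B * lsum E (fun e => ind (INR N * e - 1 <= INR k <= INR N * e)))
      by (apply Rmult_le_pos; lra).
    assert (hlt : forall u v, u < v -> INR k < u * INR N -> v * INR N < INR k + 1 -> Rabs (G u - G v) <= L / INR N).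
    { intros u v huv hu hv.
      apply Rle_trans with (L * (v - u)).
      - apply (hG (u - 1) (v + 1)); try lra. intros e he.
        destruct (Rlt_le_dec e u) as [|h3]; [left; lra|]. destruct (Rlt_le_dec v e) as [|h4]; [right; lra|].
        exfalso; apply hno; exists e; split; [exact he|].
        assert (u * INR N <= e * INR N) by (apply Rmult_le_compat_r; lra).
        assert (e * INR N <= v * INR N) by (apply Rmult_le_compat_r; lra). lra.
      - apply Rmult_le_compat_l; [lra|].
        apply Rmult_le_reg_r with (INR N); [lra|]. rewrite Rinv_l; lra. }
    destruct (Rtotal_order t s) as [h3|[->|h3]].
    + pose proof (hlt t s h3 h1 (proj2 hm1)); lra.
    + rewrite Rminus_diag, Rabs_R0; lra.
    + rewrite Rabs_minus_sym. pose proof (hlt s t h3 (proj1 hm1) h2); lra. }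
assert (hcell : forall k, Rabs (RInt G (INR k / INR N) (INR (S k) / INR N) - / INR N * G (gpt N k)) <= err k).
{ intros k.
  assert (hk : INR k / INR N <= INR (S k) / INR N).
  { apply Rmult_le_compat_r; [lra|]. rewrite S_INR; lra. }
  replace (/ INR N * G (gpt N k)) with (RInt (fun _ => G (gpt N k)) (INR k / INR N) (INR (S k) / INR N)).
  2:{ rewrite RInt_const. rewrite S_INR; unfold scal; simpl; unfold mult; simpl; field; lra. }
  replace (err k) with ((INR (S k) / INR N - INR k / INR N) * (INR N * err k)).
  2:{ rewrite S_INR; field; lra. }
  change (RInt G (INR k / INR N) (INR (S k) / INR N) - RInt (fun _ => G (gpt N k)) (INR k / INR N) (INR (S k) / INR N))
   with (minus (RInt G (INR k / INR N) (INR (S k) / INR N)) (RInt (fun _ => G (gpt N k)) (INR k / INR N) (INR (S k) / INR N))).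
  rewrite <- RInt_minus; [|apply hex; exact hk|apply ex_RInt_const].
  assert (hexm : ex_RInt (fun x => minus (G x) (G (gpt N k))) (INR k / INR N) (INR (S k) / INR N)).
  { apply @ex_RInt_minus; [apply hex; exact hk|apply ex_RInt_const]. }
  eapply Rle_trans; [apply abs_RInt_le; assumption|].
  eapply Rle_trans.
  - apply (RInt_le _ (fun _ => INR N * err k)); [exact hk|apply ex_RInt_norm with (f := fun x => minus (G x) (G (gpt N k))); exact hexm|apply ex_RInt_const|].
    intros x hx. eapply Rle_trans; [apply hpt; exact hx|]. right; unfold err; field; lra.
  - rewrite RInt_const. right; unfold scal; simpl; unfold mult; simpl; ring. }
assert (hsum : forall j, Rabs (RInt G 0 (INR j / INR N) - / INR N * rsum j (fun k => G (gpt N k))) <= rsum j err).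
{ induction j as [|j IH].
  - simpl. unfold Rdiv; rewrite Rmult_0_l, RInt_point. unfold zero; simpl.
    rewrite Rmult_0_r, Rminus_0_r, Rabs_R0; lra.
  - cbn [rsum].
    assert (hj : 0 <= INR j / INR N) by (apply Rmult_le_pos; [apply pos_INR|lra]).
    assert (hj' : INR j / INR N <= INR (S j) / INR N).
    { apply Rmult_le_compat_r; [lra|]. rewrite S_INR; lra. }
    rewrite <- (RInt_Chasles G 0 (INR j / INR N)) by (apply hex; lra).
    unfold plus; simpl plus. specialize (hcell j).
    match goal with |- Rabs ?e <= _ => replace e with
      ((RInt G 0 (INR j / INR N) - / INR N * rsum j (fun k => G (gpt N k))) +
       (RInt G (INR j / INR N) (INR (S j) / INR N) - / INR N * G (gpt N j))) by (cbn; ring) end.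
    eapply Rle_trans; [apply Rabs_triang|lra]. }
specialize (hsum N). unfold Rdiv in hsum at 1. rewrite Rinv_r in hsum by lra.
eapply Rle_trans; [exact hsum|].
unfold err. rewrite rsum_scal, rsum_plus, rsum_const, rsum_scal.
assert (hl : rsum N (fun k => lsum E (fun e => ind (INR N * e - 1 <= INR k <= INR N * e))) <= 2 * INR (length E)).
{ clear -hp. induction E as [|e E IH]; cbn [lsum fold_right length].
  - rewrite rsum_const; simpl; lra.
  - rewrite rsum_plus, S_INR. unfold lsum in IH.
    pose proof (count_interval N (INR N * e - 1) (INR N * e) ltac:(lra)). lra. }
apply (Rmult_le_compat_l (2 * B)) in hl; [|lra].
apply Rle_trans with (/ INR N * (INR N * (L / INR N) + 2 * B * (2 * INR (length E)))).
- apply Rmult_le_compat_l; lra.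
- right; field; lra.
Qed.

(** [E] holds reference values: 0 and 1 at the start, then every variable fixed by an outer
    integral. Comparing in both directions records ties as well. *)
Definition same_order (m : nat) (E : list R) (w w' : nat -> R) : Prop :=
  (forall i e, (i < m)%nat -> In e E -> (w i < e <-> w' i < e) /\ (e < w i <-> e < w' i)) /\
  (forall i j, (i < m)%nat -> (j < m)%nat -> (w i < w j <-> w' i < w' j)).

Definition order_invariant (m : nat) (E : list R) (F : (nat -> R) -> R) : Prop :=
  forall w w', same_order m E w w' -> F w = F w'.

Lemma order_invariant_cons m E F t : order_invariant (S m) E F ->
  order_invariant m (t :: E) (fun w => F (cons_fun t w)).
Proof.
intros hF w w' [h1 h2]; apply hF; split.
- intros [|i] e hi he; simpl; [tauto|]. apply h1; [lia|right; exact he].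
- intros [|i] [|j] hi hj; simpl.
  + tauto.
  + apply (h1 j t); [lia|left; reflexivity].
  + apply (h1 i t); [lia|left; reflexivity].
  + apply h2; lia.
Qed.

Lemma same_order_move m E t t' w : t < t' -> (forall e, In e E -> e < t \/ t' < e) ->
  (forall i, (i < m)%nat -> ~ (t <= w i <= t')) ->
  same_order (S m) E (cons_fun t w) (cons_fun t' w).
Proof.
intros ht hE hw; split.
- intros [|i] e hi he; simpl; [|tauto]. destruct (hE e he); lra.
- intros [|i] [|j] hi hj; simpl; try tauto.
  + lra.
  + assert (h := hw j ltac:(lia)). lra.
  + assert (h := hw i ltac:(lia)). lra.
Qed.

(* Moving the first argument from [t] to [t'] alters [F] only where another coordinate lies
   in [t, t']; the proportion of such grid points is at most [m (t' - t + 1 / N)], so the inner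
   integral is Lipschitz between consecutive points of [E]. *)
Lemma MInt_grid_approx m e B : 0 <= B -> exists K, 0 <= K /\
  forall E F, length E = e -> order_invariant m E F -> (forall w, Rabs (F w) <= B) ->
  exists v, MInt m F v /\ forall N, (0 < N)%nat -> Rabs (v - gsum N m F) <= K / INR N.
Proof.
intros hB; revert e; induction m as [|m IH]; intros e.
- exists 0; split; [lra|]. intros E F _ _ _. exists (F (fun _ => 0)); split; [reflexivity|].
  intros N hN; simpl; rewrite Rminus_diag, Rabs_R0. unfold Rdiv; lra.
- destruct (IH (S e)) as [K [hK hIH]].
  set (L := 2 * B * INR m).
  assert (hL : 0 <= L) by (unfold L; apply Rmult_le_pos; [lra|apply pos_INR]).
  exists (K + (L + 4 * B * INR e)). split.
  { pose proof (pos_INR e). assert (0 <= 4 * B * INR e) by (apply Rmult_le_pos; lra). lra. }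
  intros E F hE hF hFB.
  assert (hG : forall t, exists v, MInt m (fun w => F (cons_fun t w)) v /\
    forall N, (0 < N)%nat -> Rabs (v - gsum N m (fun w => F (cons_fun t w))) <= K / INR N).
  { intros t; apply (hIH (t :: E)); [simpl; lia|apply order_invariant_cons; exact hF|intros; apply hFB]. }
  destruct (choice _ hG) as [G hGG]; clear hG.
  assert (hsmall : forall x c, 0 <= c -> (forall N, (0 < N)%nat -> x <= c / INR N) -> x <= 0).
  { intros x c hc h. apply le_epsilon; intros eps heps.
    destruct (nfloor_ex (c / eps)) as [N hN]; [apply Rmult_le_pos; [lra|left; apply Rinv_0_lt_compat; lra]|].
    specialize (h (S N) ltac:(lia)). rewrite S_INR in h.
    rewrite Rplus_0_l. eapply Rle_trans; [exact h|].
    pose proof (pos_INR N).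
    apply Rle_div_l; [lra|]. destruct hN as [_ hN]. apply Rlt_div_l in hN; lra. }
  (* The exact inner integrals inherit the Lipschitz bound from their grid averages, since all
     discrepancies are multiples of 1/N. In [L], the factor 2B is the largest possible change of [F]
     and [m] the number of coordinates that can be hit. *)
  assert (hlip : forall a b, lip_off E L a b G).
  { intros a b t t' _ htt _ hno.
    cut (Rabs (G t - G t') - L * (t' - t) <= 0); [lra|].
    apply hsmall with (L + 2 * K); [lra|]. intros N hN.
    pose proof (INR_gt0 N hN) as hp.
    pose proof (proj2 (hGG t) N hN) as g1. pose proof (proj2 (hGG t') N hN) as g2.
    assert (g3 := gsum_close N m hN (fun w => F (cons_fun t w)) (fun w => F (cons_fun t' w)) 0 (2 * B) t t'
      ltac:(lra) ltac:(lra)).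
    assert (g4 : Rabs (gsum N m (fun w => F (cons_fun t w)) - gsum N m (fun w => F (cons_fun t' w)))
      <= 0 + 2 * B * INR m * (t' - t + / INR N)).
    { apply g3. intros w.
      assert (h0 : 0 <= hits t t' m w) by (apply rsum_ge0; intros; apply ind_ge0).
      destruct (classic (exists i, (i < m)%nat /\ t <= w i <= t')) as [[i [hi hw]]|hw].
      - pose proof (hits_ge1 t t' m w i hi hw).
        assert (2 * B * 1 <= 2 * B * hits t t' m w) by (apply Rmult_le_compat_l; lra).
        pose proof (hFB (cons_fun t w)) as b1; pose proof (hFB (cons_fun t' w)) as b2.
        apply Rabs_le_between in b1; apply Rabs_le_between in b2. apply Rabs_le; lra.
      - rewrite (hF (cons_fun t w) (cons_fun t' w)).
        + rewrite Rminus_diag, Rabs_R0. assert (0 <= 2 * B * hits t t' m w) by (apply Rmult_le_pos; lra). lra.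
        + apply same_order_move; auto. intros i hi h; apply hw; exists i; auto. }
    fold L in g4. unfold Rdiv in *.
    rewrite Rmult_plus_distr_l in g4. rewrite Rmult_plus_distr_r.
    apply Rabs_le_between in g1; apply Rabs_le_between in g2; apply Rabs_le_between in g4.
    assert (Rabs (G t - G t') <= L * (t' - t) + (L * / INR N + 2 * K * / INR N)); [|lra].
    apply Rabs_le; lra. }
  assert (hGB : forall t, Rabs (G t) <= B).
  { intros t. cut (Rabs (G t) - B <= 0); [lra|]. apply hsmall with K; [lra|].
    intros N hN. pose proof (proj2 (hGG t) N hN) as g1.
    pose proof (gsum_bound N m (fun w => F (cons_fun t w)) B hN (fun w => hFB _)) as g2.
    apply Rabs_le_between in g1; apply Rabs_le_between in g2.
    assert (Rabs (G t) <= B + K / INR N); [apply Rabs_le; lra|lra]. }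
  assert (hex : ex_RInt G 0 1) by (apply (lip_off_integrable E L G hL); [lra|apply hlip]).
  exists (RInt G 0 1); split.
  + exists G; split; [intros t _; apply hGG|].
    exists (ex_RInt_Reals_0 _ _ _ hex). symmetry; apply RInt_Reals.
  + intros N hN. pose proof (INR_gt0 N hN) as hp. pose proof (Rinv_0_lt_compat _ hp).
    pose proof (midpoint_error E L B G N hL hB hN hGB hlip) as h1. rewrite hE in h1.
    cbn [gsum].
    assert (h2 : Rabs (/ INR N * rsum N (fun k => G (gpt N k)) -
      / INR N * rsum N (fun k => gsum N m (fun w => F (cons_fun (gpt N k) w)))) <= K / INR N).
    { rewrite <- Rmult_minus_distr_l, <- rsum_minus, Rabs_mult, (Rabs_pos_eq (/ INR N)) by lra.
      apply Rle_trans with (/ INR N * rsum N (fun _ => K / INR N)).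
      - apply Rmult_le_compat_l; [lra|]. eapply Rle_trans; [apply rsum_abs|].
        apply rsum_le; intros k _; apply hGG; exact hN.
      - rewrite rsum_const. right; field; lra. }
    replace ((K + (L + 4 * B * INR e)) / INR N) with ((L + 4 * B * INR e) / INR N + K / INR N) by (field; lra).
    eapply Rle_trans; [|apply Rplus_le_compat; [exact h1|exact h2]].
    eapply Rle_trans; [|apply Rabs_triang]. right; f_equal; ring.
Qed.

(** * Naming interior generators by observations *)

Definition mkpt (d : nat) (g : nat -> R) : list R := map g (seq 0 d).

Lemma length_mkpt d g : length (mkpt d g) = d.
Proof. unfold mkpt; rewrite length_map, length_seq; reflexivity. Qed.

Lemma coord_mkpt d g k : (k < d)%nat -> coord (mkpt d g) k = g k.
Proof.
intros hk; unfold coord, mkpt.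
rewrite nth_indep with (d' := g 0%nat) by (rewrite length_map, length_seq; exact hk).
rewrite map_nth, seq_nth by exact hk; reflexivity.
Qed.

Lemma pt_ext d x y : length x = d -> length y = d ->
  (forall j, (j < d)%nat -> coord x j = coord y j) -> x = y.
Proof. intros hx hy h; apply nth_ext with 0 0; [congruence|]. intros j hj; apply h; lia. Qed.

(** Gives room, in the minimality argument, to lower one coordinate from [c] without passing any
    observed value smaller than [c]. *)
Lemma gap_below n (g : nat -> R) c : 0 < c ->
  exists y, 0 <= y < c /\ forall i, (i < n)%nat -> g i < c -> g i <= y.
Proof.
intros hc; induction n as [|n [y [hy IH]]].
- exists 0; split; [lra|lia].
- destruct (Rlt_dec (g n) c) as [h|h].
  + exists (Rmax y (g n)); split.
    * unfold Rmax; destruct Rle_dec; lra.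
    * intros i hi hgi. destruct (Nat.eq_dec i n) as [->|hne]; [apply Rmax_r|].
      eapply Rle_trans; [apply IH; [lia|exact hgi]|apply Rmax_l].
  + exists y; split; [exact hy|]. intros i hi hgi.
    destruct (Nat.eq_dec i n) as [->|hne]; [lra|]. apply IH; [lia|exact hgi].
Qed.

(** If no observation supports coordinate j, that coordinate can be lowered a little inside the
    region, against minimality; positivity leaves the room. Conversely, a point of the region below
    [x] and strictly smaller in coordinate j would be strictly dominated by the observation
    supporting j. *)
Lemma interior_generatorP d n w x :
  is_generator d n w x /\ is_interior d x <->
  length x = d /\ (forall j, (j < d)%nat -> 0 < coord x j < 1) /\
  (forall i, (i < n)%nat -> ~ (forall j, (j < d)%nat -> coord x j < obs d w i j)) /\
  (forall j, (j < d)%nat -> exists i, (i < n)%nat /\ obs d w i j = coord x j /\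
     forall k, (k < d)%nat -> k <> j -> coord x k < obs d w i k).
Proof.
split.
- intros [[[hlen [hx hS]] hmin] hint].
  assert (hpos : forall j, (j < d)%nat -> 0 < coord x j < 1).
  { intros j hj; specialize (hx j hj); specialize (hint j hj); lra. }
  split; [exact hlen|]. split; [exact hpos|]. split; [exact hS|].
  intros j hj; apply NNPP; intros hno.
  destruct (gap_below n (fun i => obs d w i j) (coord x j) (proj1 (hpos j hj))) as [y [hy hgap]].
  set (z := mkpt d (fun k => if Nat.eq_dec k j then y else coord x k)).
  assert (hzj : coord z j = y).
  { unfold z; rewrite coord_mkpt by exact hj; destruct (Nat.eq_dec j j); congruence. }
  assert (hzk : forall k, (k < d)%nat -> k <> j -> coord z k = coord x k).
  { intros k hk hkj; unfold z; rewrite coord_mkpt by exact hk; destruct (Nat.eq_dec k j); congruence. }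
  assert (hz : z = x).
  { apply hmin.
    - split; [apply length_mkpt|]. split.
      + intros k hk. destruct (Nat.eq_dec k j) as [->|hkj].
        * specialize (hx j hj); lra.
        * rewrite hzk by assumption; apply hx; exact hk.
      + intros i hi hlt.
        assert (hxi : forall k, (k < d)%nat -> k <> j -> coord x k < obs d w i k).
        { intros k hk hkj; rewrite <- hzk by assumption; apply hlt; exact hk. }
        specialize (hlt j hj); rewrite hzj in hlt.
        destruct (Rtotal_order (obs d w i j) (coord x j)) as [h|[h|h]].
        * specialize (hgap i hi h); lra.
        * apply hno; exists i; auto.
        * apply (hS i hi). intros k hk. destruct (Nat.eq_dec k j) as [->|hkj]; [exact h|auto].
    - intros k hk. destruct (Nat.eq_dec k j) as [->|hkj]; [lra|rewrite hzk by assumption; lra]. }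
  rewrite hz in hzj; lra.
- intros [hlen [hpos [hS hrep]]]. split.
  + split.
    * split; [exact hlen|]. split; [|exact hS]. intros j hj; specialize (hpos j hj); lra.
    * intros y [hly [_ hyS]] hle. apply pt_ext with d; auto.
      intros j hj. apply NNPP; intros hne.
      assert (hlt : coord y j < coord x j) by (specialize (hle j hj); lra).
      destruct (hrep j hj) as [i [hi [hij hik]]].
      apply (hyS i hi). intros k hk. destruct (Nat.eq_dec k j) as [->|hkj]; [lra|].
      specialize (hle k hk); specialize (hik k hk hkj); lra.
  + intros j hj; specialize (hpos j hj); lra.
Qed.

Lemma finite_card_list {A : Type} (P : A -> Prop) (l : list A) :
  NoDup l -> (forall x, In x l <-> P x) -> finite_card P = length l.
Proof.
intros hl hP; unfold finite_card.
destruct excluded_middle_informative as [H|H]; [|exfalso; apply H; exists l; auto].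
destruct constructive_indefinite_description as [l' [hl' hP']]; simpl.
apply Permutation_length, NoDup_Permutation; auto.
intros x; rewrite hP, hP'; tauto.
Qed.

(* Each interior generator is named once: [t j] is the first observation that shares
   coordinate [j] with the generator and exceeds it in every other coordinate. *)
Definition names_generator (d n : nat) (w : nat -> R) (t : nat -> nat) : Prop :=
  (forall j, (j < d)%nat -> 0 < obs d w (t j) j /\ obs d w (t j) j < 1) /\
  (forall i, (i < n)%nat -> ~ (forall j, (j < d)%nat -> obs d w (t j) j < obs d w i j)) /\
  (forall j k, (j < d)%nat -> (k < d)%nat -> k <> j -> obs d w (t k) k < obs d w (t j) k) /\
  (forall j i, (j < d)%nat -> (i < t j)%nat ->
     ~ (~ obs d w i j < obs d w (t j) j /\ ~ obs d w (t j) j < obs d w i j /\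
        forall k, (k < d)%nat -> k <> j -> obs d w (t k) k < obs d w i k)).

Lemma named_point d n w t : (forall j, (j < d)%nat -> (t j < n)%nat) -> names_generator d n w t ->
  is_generator d n w (mkpt d (fun j => obs d w (t j) j)) /\
  is_interior d (mkpt d (fun j => obs d w (t j) j)).
Proof.
intros ht [h1 [h2 [h3 _]]]; apply interior_generatorP; split; [apply length_mkpt|]. split; [|split].
- intros j hj; rewrite coord_mkpt by exact hj; auto.
- intros i hi h; apply (h2 i hi); intros j hj. rewrite <- (coord_mkpt d (fun j => obs d w (t j) j)) by exact hj; auto.
- intros j hj; exists (t j); split; [auto|]. rewrite coord_mkpt by exact hj; split; [reflexivity|].
  intros k hk hkj; rewrite coord_mkpt by exact hk; auto.
Qed.

Lemma generator_named d n w x : is_generator d n w x /\ is_interior d x ->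
  exists t, (forall j, (j < d)%nat -> (t j < n)%nat) /\ names_generator d n w t /\
    x = mkpt d (fun j => obs d w (t j) j).
Proof.
rewrite interior_generatorP; intros [hlen [hpos [hS hrep]]].
set (A := fun j i => (i < n)%nat /\ obs d w i j = coord x j /\
  forall k, (k < d)%nat -> k <> j -> coord x k < obs d w i k).
assert (hmin : forall j, exists i, (j < d)%nat -> A j i /\ forall i', (i' < i)%nat -> ~ A j i').
{ intros j. destruct (lt_dec j d) as [hj|hj]; [|exists 0%nat; tauto].
  destruct (hrep j hj) as [i hi]. fold (A j i) in hi. revert hi.
  induction i as [i IH] using lt_wf_ind; intros hi.
  destruct (classic (exists i', (i' < i)%nat /\ A j i')) as [[i' [h1 h2]]|hno].
  - exact (IH i' h1 h2).
  - exists i; intros _; split; [exact hi|]. intros i' h1 h2; apply hno; exists i'; auto. }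
destruct (choice _ hmin) as [t ht]; exists t.
assert (hA : forall j, (j < d)%nat -> A j (t j)) by (intros j hj; apply ht; exact hj).
assert (he : forall j, (j < d)%nat -> obs d w (t j) j = coord x j) by (intros j hj; apply hA; exact hj).
split; [intros j hj; apply hA; exact hj|]. split.
- split; [|split; [|split]].
  + intros j hj; rewrite he by exact hj; auto.
  + intros i hi h; apply (hS i hi); intros j hj; rewrite <- he by exact hj; auto.
  + intros j k hj hk hkj; rewrite (he k hk); apply (hA j hj); auto.
  + intros j i hj hi [h1 [h2 h3]]. apply (proj2 (ht j hj) i hi).
    split; [|split].
    * pose proof (proj1 (hA j hj)); lia.
    * rewrite he in h1, h2 by exact hj; lra.
    * intros k hk hkj; rewrite <- (he k hk); auto.
- apply pt_ext with d; [exact hlen|apply length_mkpt|].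
  intros j hj; rewrite coord_mkpt by exact hj; rewrite he; auto.
Qed.

(** Of two different candidates for [t j], the smaller violates the first-observation clause of the
    other name. *)
Lemma name_unique d n w t t' : names_generator d n w t -> names_generator d n w t' ->
  mkpt d (fun j => obs d w (t j) j) = mkpt d (fun j => obs d w (t' j) j) ->
  forall j, (j < d)%nat -> t j = t' j.
Proof.
intros [_ [_ [h3 h4]]] [_ [_ [h3' h4']]] hp.
assert (he : forall j, (j < d)%nat -> obs d w (t j) j = obs d w (t' j) j).
{ intros j hj. rewrite <- (coord_mkpt d (fun j => obs d w (t j) j)), <- (coord_mkpt d (fun j => obs d w (t' j) j)) by exact hj.
  rewrite hp; reflexivity. }
intros j hj. destruct (lt_eq_lt_dec (t j) (t' j)) as [[h|h]|h]; [|exact h|]; exfalso.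
- apply (h4' j (t j) hj h). rewrite (he j hj). split; [lra|split; [lra|]].
  intros k hk hkj; rewrite <- he by exact hk; auto.
- apply (h4 j (t' j) hj h). rewrite (he j hj). split; [lra|split; [lra|]].
  intros k hk hkj; rewrite he by exact hk; auto.
Qed.

Lemma same_order_sym m E w w' : same_order m E w w' -> same_order m E w' w.
Proof.
intros [h1 h2]; split.
- intros i e hi he; destruct (h1 i e hi he); split; symmetry; assumption.
- intros i j hi hj; symmetry; auto.
Qed.

(** Equality of coordinates is spelled in [names_generator] as two negated strict inequalities, so
    every clause is built from comparisons that [same_order] preserves. *)
Lemma names_generator_order d n w w' t : (forall j, (j < d)%nat -> (t j < n)%nat) ->
  same_order (d * n) (0 :: 1 :: nil) w w' -> names_generator d n w t -> names_generator d n w' t.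
Proof.
intros ht [s1 s2].
assert (hidx : forall i j, (i < n)%nat -> (j < d)%nat -> (i * d + j < d * n)%nat) by (intros; nia).
assert (hlt : forall i i' j, (i < n)%nat -> (i' < n)%nat -> (j < d)%nat ->
  (obs d w i j < obs d w i' j <-> obs d w' i j < obs d w' i' j)).
{ intros i i' j hi hi' hj; apply s2; apply hidx; assumption. }
intros [h1 [h2 [h3 h4]]]; split; [|split; [|split]].
- intros j hj. destruct (h1 j hj) as [g1 g2]. specialize (ht j hj). split.
  + apply (s1 _ 0 (hidx _ _ ht hj)); [left; reflexivity|exact g1].
  + apply (s1 _ 1 (hidx _ _ ht hj)); [right; left; reflexivity|exact g2].
- intros i hi h; apply (h2 i hi); intros j hj; apply hlt; auto.
- intros j k hj hk hkj; apply hlt; auto.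
- intros j i hj hi [g1 [g2 g3]]. assert (i < n)%nat by (specialize (ht j hj); lia).
  apply (h4 j i hj hi). split; [|split].
  + rewrite hlt; auto.
  + rewrite hlt; auto.
  + intros k hk hkj; apply hlt; auto.
Qed.

(** * Falling factorials, power sums and limits with a rate *)

Fixpoint falling (n d : nat) : R :=
  match d with O => 1 | S d' => falling n d' * INR (n - d') end.

(** The factors 1 - j/n with j < d lose at most the sum of the j/n, which is below d^2/n. If n < d,
    truncated subtraction makes the product 0 and the lower bound is negative. *)
Lemma falling_ratio n d : (0 < n)%nat ->
  0 <= falling n d / INR n ^ d /\ 1 - INR d ^ 2 / INR n <= falling n d / INR n ^ d <= 1.
Proof.
intros hn; pose proof (INR_gt0 n hn) as hp.
pose proof (Rinv_0_lt_compat _ hp) as hip.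
induction d as [|d [h0 [h1 h2]]]; [simpl; lra|].
set (x := falling n d / INR n ^ d) in *.
assert (hd : 0 <= INR d) by apply pos_INR.
assert (hr : INR n - INR d <= INR (n - d) <= INR n /\ 0 <= INR (n - d)).
{ split; [|apply pos_INR]. destruct (le_lt_dec d n) as [h|h].
  - rewrite minus_INR by exact h; lra.
  - replace (n - d)%nat with 0%nat by lia. apply lt_INR in h. simpl; lra. }
set (r := INR (n - d) / INR n).
assert (hr' : 1 - INR d / INR n <= r <= 1 /\ 0 <= r).
{ unfold r; split; [split|].
  - replace (1 - INR d / INR n) with ((INR n - INR d) / INR n) by (field; lra).
    apply Rmult_le_compat_r; lra.
  - apply Rle_div_l; lra.
  - apply Rmult_le_pos; lra. }
replace (falling n (S d) / INR n ^ S d) with (x * r).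
2:{ unfold x, r; simpl; field; split; [apply pow_nonzero|]; lra. }
rewrite S_INR.
replace ((INR d + 1) ^ 2 / INR n) with (INR d ^ 2 / INR n + INR d / INR n + (INR d + 1) / INR n) by (field; lra).
assert (0 <= (INR d + 1) / INR n) by (apply Rmult_le_pos; lra).
split; [apply Rmult_le_pos; lra|]. split; nra.
Qed.

(** The difference is x - y times k + 1 monomials, each between y^k and x^k. It serves both to
    telescope power sums and to compare (1-u)^m with e^(-mu). *)
Lemma pow_diff_bounds k x y : 0 <= y <= x ->
  INR (S k) * (x - y) * y ^ k <= x ^ S k - y ^ S k <= INR (S k) * (x - y) * x ^ k.
Proof.
intros hxy; induction k as [|k IH]; [simpl; lra|].
assert (hp : 0 <= y ^ k <= x ^ k) by (split; [apply pow_le; lra|apply pow_incr; lra]).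
rewrite S_INR. change (x ^ S (S k)) with (x * x ^ S k). change (y ^ S (S k)) with (y * y ^ S k).
assert (hs : y ^ S k <= x ^ S k) by (apply pow_incr; lra).
replace (x * x ^ S k - y * y ^ S k) with (x * (x ^ S k - y ^ S k) + (x - y) * y ^ S k) by ring.
destruct IH as [IH1 IH2]. split.
- apply Rle_trans with (y * (x ^ S k - y ^ S k) + (x - y) * y ^ S k).
  + apply (Rmult_le_compat_l y) in IH1; [|lra]. simpl pow in *. nra.
  + apply Rplus_le_compat_r. apply Rmult_le_compat_r; lra.
- apply (Rmult_le_compat_l x) in IH2; [|lra].
  apply (Rmult_le_compat_l (x - y)) in hs; [|lra]. simpl pow in *. nra.
Qed.

(** The shift to [S N] skips the empty grid, where averages are meaningless. *)
Lemma is_lim_seq_rate u l K : (forall N, (0 < N)%nat -> Rabs (u N - l) <= K / INR N) ->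
  is_lim_seq (fun N => u (S N)) (Finite l).
Proof.
intros h.
assert (hK : is_lim_seq (fun N => K / INR (S N)) (Finite 0)).
{ replace (Finite 0) with (Rbar_mult (Finite K) (Finite 0)) by (simpl; rewrite Rmult_0_r; reflexivity).
  apply is_lim_seq_scal_l. apply (is_lim_seq_incr_1 (fun N => / INR N)).
  replace (Finite 0) with (Rbar_inv p_infty) by reflexivity.
  apply is_lim_seq_inv; [apply is_lim_seq_INR|discriminate]. }
apply is_lim_seq_ext with (fun N => (u (S N) - l) + l); [intros; ring|].
replace (Finite l) with (Finite (0 + l)) by (f_equal; ring).
apply is_lim_seq_plus'; [|apply is_lim_seq_const].
apply is_lim_seq_le_le with (fun N => - (K / INR (S N))) (fun N => K / INR (S N)); [| |exact hK].
- intros N. specialize (h (S N) ltac:(lia)). apply Rabs_le_between; exact h.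
- replace (Finite 0) with (Rbar_opp (Finite 0)) by (simpl; rewrite Ropp_0; reflexivity).
  apply -> is_lim_seq_opp; exact hK.
Qed.

Lemma power_sum_limit a :
  is_lim_seq (fun N => / INR (S N) ^ S a * rsum (S N) (fun k => INR k ^ a)) (Finite (/ INR (S a))).
Proof.
apply (is_lim_seq_rate (fun N => / INR N ^ S a * rsum N (fun k => INR k ^ a)) _ 1).
intros N hN; pose proof (INR_gt0 N hN) as hp.
pose proof (INR_gt0 (S a) ltac:(lia)) as ha.
(* Telescoping (k+1)^(a+1) - k^(a+1) traps N^(a+1) between (a+1) times two sums that differ by the
   single term N^a. *)
assert (hs : INR (S a) * rsum N (fun k => INR k ^ a) <= INR N ^ S a <=
             INR (S a) * (rsum N (fun k => INR k ^ a) + INR N ^ a)).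
{ clear hN hp. induction N as [|N IH].
  - simpl rsum. rewrite Rmult_0_r, Rplus_0_l. simpl INR at 1 2. rewrite pow_i by lia.
    split; [lra|]. apply Rmult_le_pos; [lra|apply pow_le; simpl; lra].
  - pose proof (pow_diff_bounds a (INR (S N)) (INR N)) as hd.
    rewrite S_INR in hd at 1 2. pose proof (pos_INR N).
    replace (INR (S N) - INR N) with 1 in hd by (rewrite S_INR; ring).
    destruct hd as [hd1 hd2]; [lra|]. cbn [rsum]. lra. }
set (s := rsum N (fun k => INR k ^ a)) in *.
assert (hN1 : 0 < INR N ^ S a) by (apply pow_lt; lra).
assert (hna : 0 < INR N ^ a) by (apply pow_lt; lra).
assert (ha1 : 1 <= INR (S a)) by (rewrite S_INR; pose proof (pos_INR a); lra).
replace (/ INR N ^ S a * s - / INR (S a)) with ((INR (S a) * s - INR N ^ S a) / (INR (S a) * INR N ^ S a)) by (field; lra).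
replace (1 / INR N) with (INR (S a) * INR N ^ a / (INR (S a) * INR N ^ S a)) by (simpl pow; field; lra).
unfold Rdiv. rewrite Rabs_mult, (Rabs_pos_eq (/ _)).
2:{ left; apply Rinv_0_lt_compat, Rmult_lt_0_compat; lra. }
apply Rmult_le_compat_r; [left; apply Rinv_0_lt_compat, Rmult_lt_0_compat; lra|].
apply Rabs_le; lra.
Qed.

(** * Counting on the grid *)

Module GridCount.
Import all_boot.
Set Implicit Arguments.
Unset Strict Implicit.
Unset Printing Implicit Defensive.
Local Open Scope nat_scope.
Delimit Scope R_scope with Re.

Definition cb (P : Prop) : bool := if excluded_middle_informative P then true else false.

Lemma cbP (P : Prop) : reflect P (cb P).
Proof. by rewrite /cb; case: excluded_middle_informative => h; constructor. Qed.

Definition natfun (m n : nat) (t : {ffun 'I_m -> 'I_n}) : nat -> nat :=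
  fun k => if insub k is Some o then val (t o) else 0.

Lemma natfunE m n (t : {ffun 'I_m -> 'I_n}) (j : 'I_m) : natfun t j = t j.
Proof. by rewrite /natfun insubT //= => h; congr (val (t _)); exact: val_inj. Qed.

Lemma natfun_lt m n (t : {ffun 'I_m -> 'I_n}) k : lt k m -> lt (natfun t k) n.
Proof. by move/ltP => hk; apply/ltP; rewrite (natfunE t (Ordinal hk)). Qed.

Lemma In_enum (T : finType) (P : pred T) x : In x (enum P) <-> P x.
Proof.
rewrite -[P x]/(x \in P) -mem_enum; elim: (enum P) => [|y s IH] //=.
rewrite inE; split.
- by case=> [->|/IH ->]; rewrite ?eqxx ?orbT.
- by case/orP => [/eqP ->|/IH]; [left|right].
Qed.

Lemma NoDup_uniq (T : eqType) (s : seq.seq T) : uniq s -> NoDup s.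
Proof.
elim: s => [|x s IH] /=; first by constructor.
case/andP=> hx /IH hs; constructor => //.
elim: s hx {hs IH} => [_ []|y s IH] /=; rewrite inE negb_or => /andP[hxy /IH hs] [hy|//].
by rewrite hy eqxx in hxy.
Qed.

(** Only the values [t j] with j < d matter to a name; finite functions count each name once, where
    functions on all naturals would repeat it infinitely often. *)
Definition count_names d n (w : nat -> R) : nat :=
  #|[pred t : {ffun 'I_d -> 'I_n} | cb (names_generator d n w (natfun t))]|.

Lemma finite_card_generators d n w :
  finite_card (fun x => is_generator d n w x /\ is_interior d x) = count_names d n w.
Proof.
set pt := fun t : {ffun 'I_d -> 'I_n} => mkpt d (fun j => obs d w (natfun t j) j).
set P := [pred t : {ffun 'I_d -> 'I_n} | cb (names_generator d n w (natfun t))].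
rewrite (@finite_card_list _ _ (List.map pt (enum P))).
- by rewrite List.length_map /count_names cardE.
- apply: NoDup_map_NoDup_ForallPairs; last exact/NoDup_uniq/enum_uniq.
  move=> t t' /In_enum /cbP ht /In_enum /cbP ht' /(name_unique _ _ _ _ _ ht ht') h.
  by apply/ffunP => j; apply/val_inj; have /= := h j (elimT ltP (ltn_ord j)); rewrite !natfunE.
- move=> x; rewrite in_map_iff; split.
  + by case=> t [<- /In_enum /cbP]; apply: named_point => j; exact: natfun_lt.
  + case/generator_named => t [ht [hn ->]].
    pose s := [ffun j : 'I_d => Ordinal (introT ltP (ht j (elimT ltP (ltn_ord j))))].
    have hs k : lt k d -> natfun s k = t k.
      by move/ltP => hk; rewrite (natfunE s (Ordinal hk)) ffunE.
    exists s; split.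
      rewrite /pt /mkpt; apply: map_ext_in => k /in_seq [_ hk]; by rewrite hs.
    apply/In_enum/cbP; case: hn => h1 [h2 [h3 h4]]; split; [|split; [|split]].
    * by move=> j hj; rewrite hs //; apply: h1.
    * by move=> i hi h; apply: (h2 i hi) => j hj; rewrite -(hs j hj); apply: h.
    * by move=> j k hj hk hkj; rewrite !hs //; apply: h3.
    * move=> j i hj; rewrite (hs j hj) => hi [g1 [g2 g3]]; apply: (h4 j i hj hi).
      by split=> //; split=> // k hk hkj; rewrite -(hs k hk); apply: g3.
Qed.

Lemma count_names_order d n w w' : same_order (d * n) [:: 0%Re; 1%Re] w w' ->
  count_names d n w = count_names d n w'.
Proof.
move=> h; apply: eq_card => t; rewrite !inE; apply/cbP/cbP.
- by apply: names_generator_order => // j; apply: natfun_lt.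
- by apply: names_generator_order (same_order_sym _ _ _ _ h) => j; apply: natfun_lt.
Qed.

Lemma count_names_le d n w : count_names d n w <= n ^ d.
Proof. by rewrite /count_names -[X in X ^ _](card_ord n) -[d in _ ^ d](card_ord d) -card_ffun; exact: max_card. Qed.

(** The default 0 beyond [m] agrees with the base case of [gsum], so averages become sums over grid
    points for an arbitrary integrand. *)
Definition grid_point N m (f : {ffun 'I_m -> 'I_N}) : nat -> R :=
  fun k => if insub k is Some o then gpt N (f o) else 0%Re.

Lemma grid_pointE N m (f : {ffun 'I_m -> 'I_N}) (o : 'I_m) : grid_point f o = gpt N (f o).
Proof. by rewrite /grid_point insubT //= => h; congr (gpt N (f _)); exact: val_inj. Qed.

Lemma rsum_INR N (f : nat -> nat) : rsum N (fun k => INR (f k)) = INR (\sum_(k < N) f k).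
Proof. by elim: N => [|N IH]; rewrite ?big_ord0 // big_ord_recr /= plus_INR -IH. Qed.

Definition fcons N m (k : 'I_N) (g : {ffun 'I_m -> 'I_N}) : {ffun 'I_m.+1 -> 'I_N} :=
  [ffun i => if unlift ord0 i is Some j then g j else k].

Lemma sum_fcons N m (H : {ffun 'I_m.+1 -> 'I_N} -> nat) :
  \sum_f H f = \sum_(k < N) \sum_(g : {ffun 'I_m -> 'I_N}) H (fcons k g).
Proof.
rewrite pair_big /=.
rewrite (reindex (fun p : 'I_N * {ffun 'I_m -> 'I_N} => fcons p.1 p.2)) //=.
exists (fun f => (f ord0, [ffun j => f (lift ord0 j)])).
- case=> k g _ /=; congr (_, _); first by rewrite ffunE unlift_none.
  by apply/ffunP => j; rewrite !ffunE liftK.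
- move=> f _; apply/ffunP => i; rewrite !ffunE /=.
  by case: unliftP => [j ->|->]; rewrite ?ffunE.
Qed.

Lemma grid_point_fcons N m (k : 'I_N) (g : {ffun 'I_m -> 'I_N}) :
  grid_point (fcons k g) = cons_fun (gpt N k) (grid_point g).
Proof.
apply: functional_extensionality => -[|i] /=.
- by rewrite (grid_pointE (fcons k g) ord0) ffunE unlift_none.
- have [hi|hi] := ltnP i m.
  + have -> : i.+1 = lift ord0 (Ordinal hi) by [].
    by rewrite grid_pointE ffunE liftK (grid_pointE g (Ordinal hi)).
  + by rewrite /grid_point !insubN // -leqNgt.
Qed.

Lemma gsum_grid_points N m (h : (nat -> R) -> nat) : 0 < N ->
  (INR N ^ m * gsum N m (fun w => INR (h w)))%Re
  = INR (\sum_(f : {ffun 'I_m -> 'I_N}) h (grid_point f)).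
Proof.
move=> hN; elim: m h => [|m IH] h.
- rewrite /= Rmult_1_l (big_pred1 [ffun=> Ordinal hN]) => [|f].
    by congr (INR (h _)); apply: functional_extensionality => k; rewrite /grid_point insubN.
  by apply/esym/eqP/ffunP => -[].
- have hp : INR N <> 0%Re by apply: not_0_INR => h0; rewrite h0 in hN.
  rewrite sum_fcons.
  pose s k := \sum_(g : {ffun 'I_m -> 'I_N}) h (cons_fun (gpt N k) (grid_point g)).
  have -> : \sum_(k < N) \sum_(g : {ffun 'I_m -> 'I_N}) h (grid_point (fcons k g)) = \sum_(k < N) s k.
    by apply: eq_bigr => k _; apply: eq_bigr => g _; rewrite grid_point_fcons.
  rewrite -rsum_INR.
  rewrite -(rsum_ext N (fun k => Rmult (INR N ^ m) (gsum N m (fun w => INR (h (cons_fun (gpt N k) w)))))).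
    rewrite rsum_scal; cbn [gsum pow]; field; exact: hp.
  by move=> k _; exact: (IH (fun w => h (cons_fun (gpt N k) w))).
Qed.

Lemma gpt_lt N a b : 0 < N -> (gpt N a < gpt N b)%Re <-> a < b.
Proof.
move=> /ltP /lt_0_INR hN; rewrite /gpt /Rdiv.
have hi := Rinv_0_lt_compat _ hN.
split.
- move/(Rmult_lt_reg_r _ _ _ hi) => h; apply/ltP/INR_lt; lra.
- by move/ltP/lt_INR => h; apply: Rmult_lt_compat_r => //; lra.
Qed.

Lemma gpt_inside N a : a < N -> (0 < gpt N a /\ gpt N a < 1)%Re.
Proof.
move=> /ltP ha; have hN : Rlt 0 (INR N) by apply: lt_0_INR; lia.
have hi := Rinv_0_lt_compat _ hN; have h0 := pos_INR a.
have h1 : Rle (INR a + 1) (INR N) by rewrite -S_INR; apply: le_INR.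
split.
- by apply: Rmult_lt_0_compat => //; lra.
- apply: (Rmult_lt_reg_r (INR N)) => //; rewrite /gpt /Rdiv Rmult_assoc Rinv_l; lra.
Qed.

(** * Counting observation matrices on the grid by their names *)

Section Flatten.
Variables (d n N : nat).
Hypothesis d_gt0 : 0 < d.

Fact flat_col_lt k : k %% d < d. Proof. by rewrite ltn_mod. Qed.
Fact flat_row_lt (k : 'I_(d * n)) : k %/ d < n. Proof. by rewrite ltn_divLR // [n * d]mulnC. Qed.
Fact flat_idx_lt (i : 'I_n) (j : 'I_d) : i * d + j < d * n.
Proof.
have h : i * d + j < i.+1 * d by rewrite mulSn addnC ltn_add2r.
by apply: leq_trans h _; rewrite mulnC leq_mul2l ltn_ord orbT.
Qed.

Definition flatten (W : {ffun 'I_n -> {ffun 'I_d -> 'I_N}}) : {ffun 'I_(d * n) -> 'I_N} :=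
  [ffun k => W (Ordinal (flat_row_lt k)) (Ordinal (flat_col_lt k))].

Lemma flattenE W i j : flatten W (Ordinal (flat_idx_lt i j)) = W i j.
Proof.
rewrite ffunE; congr (W _ _); apply: val_inj => /=.
- by rewrite divnMDl // divn_small ?addn0.
- by rewrite modnMDl modn_small.
Qed.

Lemma flatten_bij : bijective flatten.
Proof.
exists (fun f : {ffun 'I_(d * n) -> 'I_N} => [ffun i => [ffun j => f (Ordinal (flat_idx_lt i j))]]).
- by move=> W; apply/ffunP => i; apply/ffunP => j; rewrite ffunE [LHS]ffunE flattenE.
- move=> f; apply/ffunP => k; rewrite !ffunE; congr (f _); apply: val_inj => /=.
  by rewrite -divn_eq.
Qed.

Lemma obs_flatten W (i : 'I_n) (j : 'I_d) : obs d (grid_point (flatten W)) i j = gpt N (W i j).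
Proof. by rewrite /obs -flattenE -grid_pointE. Qed.

(** What is left of [names_generator] at midpoints without ties: the conditions at 0 and 1 hold
    automatically, and the first-observation clause is vacuous. The remaining conditions split into
    one per observation once the generator is fixed. *)
Definition strict_name (W : {ffun 'I_n -> {ffun 'I_d -> 'I_N}}) (t : {ffun 'I_d -> 'I_n}) : bool :=
  [forall j, forall k, (k != j) ==> (W (t k) k < W (t j) k)] &&
  [forall i, exists j, W i j <= W (t j) j].

Hypothesis N_gt0 : 0 < N.

Lemma names_strict W t : names_generator d n (grid_point (flatten W)) (natfun t) -> strict_name W t.
Proof.
case=> _ [h2 [h3 _]]; apply/andP; split.
- apply/forallP => j; apply/forallP => k; apply/implyP => hkj.
  have := h3 j k (elimT ltP (ltn_ord j)) (elimT ltP (ltn_ord k)).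
  rewrite !natfunE !obs_flatten gpt_lt //; apply=> /val_inj h; by rewrite h eqxx in hkj.
- apply/forallP => i; apply/existsP; apply: NNPP => hno.
  apply: (h2 i (elimT ltP (ltn_ord i))) => j /ltP hj.
  have := natfunE t (Ordinal hj) => /= ->.
  rewrite (obs_flatten W _ (Ordinal hj)) (obs_flatten W i (Ordinal hj)) gpt_lt // ltnNge.
  by apply/negP => h; apply: hno; exists (Ordinal hj).
Qed.

Lemma strict_names W t : injective (flatten W) -> strict_name W t ->
  names_generator d n (grid_point (flatten W)) (natfun t).
Proof.
move=> hinj /andP[/forallP h3 /forallP h2].
have inst (j : 'I_d) : natfun t j = t j by exact: natfunE.
split; [|split; [|split]].
- move=> j /ltP hj; have /= -> := inst (Ordinal hj).
  by rewrite (obs_flatten W _ (Ordinal hj)); apply: gpt_inside.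
- move=> i /ltP hi h; have /existsP[j] := h2 (Ordinal hi).
  rewrite leqNgt => /negP; apply; rewrite -(gpt_lt _ _ N_gt0) -!obs_flatten -inst; apply: h.
  exact/ltP.
- move=> j k /ltP hj /ltP hk hkj.
  have /= -> := inst (Ordinal hj); have /= -> := inst (Ordinal hk).
  rewrite (obs_flatten W _ (Ordinal hk)) (obs_flatten W (t (Ordinal hj)) (Ordinal hk)) gpt_lt //.
  have /forallP/(_ (Ordinal hk))/implyP := h3 (Ordinal hj); apply.
  by apply/eqP => -[].
(* A rival of [t j] would share its value in coordinate j, which injectivity of the flattened matrix
   forbids. *)
- move=> j i /ltP hj; have /= -> := inst (Ordinal hj) => /ltP hi [g1 [g2 _]].
  have hin : i < n by apply: ltn_trans hi _.
  move: g1 g2; rewrite (obs_flatten W _ (Ordinal hj)) (obs_flatten W (Ordinal hin) (Ordinal hj)) !gpt_lt // => /negP g1 /negP g2.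
  have /hinj : flatten W (Ordinal (flat_idx_lt (Ordinal hin) (Ordinal hj))) = flatten W (Ordinal (flat_idx_lt (t (Ordinal hj)) (Ordinal hj))).
    by rewrite !flattenE; apply: val_inj; apply/eqP; rewrite eqn_leq leqNgt g2 leqNgt g1.
  case=> /eqP; rewrite eqn_add2r eqn_pmul2r // => /eqP h.
  by rewrite h ltnn in hi.
Qed.

Lemma count_names_flatten W :
  count_names d n (grid_point (flatten W)) <= \sum_t strict_name W t
  <= count_names d n (grid_point (flatten W)) + ~~ injectiveb (flatten W) * n ^ d.
Proof.
have -> : \sum_t strict_name W t = #|strict_name W|.
  by rewrite -sum1_card [RHS]big_mkcond; apply: eq_bigr => t _; rewrite unfold_in -/(strict_name W t); case: (strict_name W t).
apply/andP; split.
- by apply: subset_leq_card; apply/subsetP => t; rewrite inE => /cbP /names_strict.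
- case: injectiveP => [hinj|_] /=.
  + rewrite mul0n addn0; apply: subset_leq_card; apply/subsetP => t ht; rewrite inE.
    by apply/cbP/strict_names.
  + apply: leq_trans (leq_addl _ _); rewrite mul1n.
    by rewrite -[X in X ^ _](card_ord n) -[d in _ ^ d](card_ord d) -card_ffun; exact: max_card.
Qed.

(** The two counts differ only at matrices with ties, where the trivial bound n^d on the number of
    names is enough: their proportion among all matrices tends to 0. *)
Lemma sum_count_names :
  \sum_(f : {ffun 'I_(d * n) -> 'I_N}) count_names d n (grid_point f)
  <= \sum_t \sum_W strict_name W t
  <= \sum_(f : {ffun 'I_(d * n) -> 'I_N}) count_names d n (grid_point f) + (N ^ (d * n) - N ^_ (d * n)) * n ^ d.
Proof.
rewrite exchange_big /= (reindex flatten) /=; last exact/onW_bij/flatten_bij.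
apply/andP; split; first by apply: leq_sum => W _; case/andP: (count_names_flatten W).
have h : \sum_W \sum_t strict_name W t <=
  \sum_W (count_names d n (grid_point (flatten W)) + ~~ injectiveb (flatten W) * n ^ d).
  by apply: leq_sum => W _; case/andP: (count_names_flatten W).
apply: (leq_trans h); rewrite big_split leq_add2l -big_distrl leq_mul2r; apply/orP; right.
rewrite -(reindex flatten (P := xpredT) (F := fun f : {ffun 'I_(d * n) -> 'I_N} => ~~ injectiveb f : nat)) /=; last exact/onW_bij/flatten_bij.
have hc : #|{ffun 'I_(d * n) -> 'I_N}| = N ^ (d * n) by rewrite card_ffun !card_ord.
have hi := card_inj_ffuns 'I_(d * n) 'I_N; rewrite !card_ord in hi.
rewrite -hc -(cardsC [set f : {ffun 'I_(d * n) -> 'I_N} | injectiveb f]) hi addKn -sum1_card.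
by rewrite [X in _ <= X]big_mkcond; apply: leq_sum => f _; rewrite !inE; case: (injectiveb f).
Qed.

Lemma card_familyE (aT rT : finType) (F : aT -> pred rT) : #|family F| = \prod_i #|F i|.
Proof. by rewrite card_family foldrE big_image. Qed.

Lemma card_above (a : 'I_N) : #|[pred b : 'I_N | a < b]| = N - a.+1.
Proof.
rewrite -sum1_card big_mkcond /=; case: a => a _ /=.
under eq_bigr => b _ do rewrite inE /=.
have aux M : \sum_(b < M) (if a < b then 1 else 0) = M - a.+1.
  elim: M => [|M IH]; first by rewrite big_ord0.
  rewrite big_ord_recr /= IH; case: ltnP => h; first by rewrite addn1 -subSn.
  by rewrite addn0 subSS subnS; move: h; rewrite -subn_eq0 => /eqP ->.
exact: aux.
Qed.

(** Independence in counting form: with the name [t] and the generator [x] fixed, the matrices form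
    a product of conditions on single rows. The row named for j agrees with [x] at j and exceeds it
    elsewhere; any other row must fail to exceed [x] everywhere. *)
Definition fiber (t : {ffun 'I_d -> 'I_n}) (x : {ffun 'I_d -> 'I_N}) (i : 'I_n) : pred {ffun 'I_d -> 'I_N} :=
  fun v => if [pick j | t j == i] is Some j then (v j == x j) && [forall k, (k != j) ==> (x k < v k)]
           else [exists j, v j <= x j].

Lemma fiberP (t : {ffun 'I_d -> 'I_n}) x W : injective t ->
  strict_name W t && ([ffun k => W (t k) k] == x) = (W \in family (fiber t x)).
Proof.
move=> ht; apply/andP/familyP.
- case=> /andP[/forallP h1 /forallP h2] /eqP <- i; rewrite unfold_in /fiber.
  case: pickP => [j /eqP <-|_].
  + rewrite ffunE eqxx; apply/forallP => k; apply/implyP => hk; rewrite ffunE.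
    by have /forallP/(_ k)/implyP := h1 j; apply.
  + by have /existsP[j hj] := h2 i; apply/existsP; exists j; rewrite ffunE.
- move=> h.
  have hx k : W (t k) k = x k.
    have := h (t k); rewrite unfold_in /fiber; case: pickP => [j /eqP /ht <-|/(_ k)]; last by rewrite eqxx.
    by case/andP=> /eqP.
  split; last by apply/eqP/ffunP => k; rewrite ffunE.
  apply/andP; split.
  + apply/forallP => j; apply/forallP => k; rewrite hx.
    have := h (t j); rewrite unfold_in /fiber; case: pickP => [j' /eqP /ht ->|/(_ j)]; last by rewrite eqxx.
    by case/andP=> _ /forallP.
  + apply/forallP => i; apply/existsP.
    have := h i; rewrite unfold_in /fiber; case: pickP => [j /eqP <-|_].
    * by exists j; rewrite leqnn.
    * by case/existsP=> j hj; exists j; rewrite hx.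
Qed.

Lemma card_fiber_named (t : {ffun 'I_d -> 'I_n}) x (j : 'I_d) : injective t ->
  #|fiber t x (t j)| = \prod_(k | k != j) (N - (x k).+1).
Proof.
move=> ht.
transitivity #|family (fun k => if k == j then pred1 (x j) else [pred b : 'I_N | x k < b])|.
- apply: eq_card => v; rewrite unfold_in /fiber.
  case: pickP => [j' /eqP /ht ->|/(_ j)]; last by rewrite eqxx.
  apply/andP/familyP => [[h1 /forallP h2] k|h].
  + by case: eqVneq => [->//|hk]; rewrite inE; have /implyP := h2 k; apply.
  + split; first by have := h j; rewrite eqxx.
    by apply/forallP => k; apply/implyP => hk; have := h k; rewrite (negPf hk).
- rewrite card_familyE (bigD1 j) //= eqxx card1 mul1n.
  by apply: eq_bigr => k hk; rewrite (negPf hk) card_above.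
Qed.

Lemma card_fiber_other (t : {ffun 'I_d -> 'I_n}) (x : {ffun 'I_d -> 'I_N}) (i : 'I_n) : (forall j, t j != i) ->
  #|fiber t x i| = N ^ d - \prod_k (N - (x k).+1).
Proof.
move=> hi.
have hc : #|{ffun 'I_d -> 'I_N}| = N ^ d by rewrite card_ffun !card_ord.
have -> : \prod_k (N - (x k).+1) = #|family (fun k => [pred b : 'I_N | x k < b])|.
  by rewrite card_familyE; apply: eq_bigr => k _; rewrite card_above.
rewrite -hc -(cardC (family (fun k => [pred b : 'I_N | x k < b]))) addKn.
apply: eq_card => v; rewrite unfold_in /fiber !inE.
case: pickP => [j|_]; first by rewrite (negPf (hi j)).
apply/existsP/idP.
- by case=> j hj; apply/negP => /familyP/(_ j); rewrite inE ltnNge hj.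
- move=> h; apply: NNPP => hno; case/negP: h; apply/familyP => k; rewrite inE ltnNge.
  by apply/negP => hk; apply: hno; exists k.
Qed.

(** Coordinate k is free to exceed [x k] in the named rows of all j other than k, so its factor
    occurs d - 1 times. The n - d unnamed rows each contribute the complement of the box above [x].
    Hence the two exponents of the expectation formula. *)
Lemma card_fiber (t : {ffun 'I_d -> 'I_n}) x : injective t ->
  #|family (fiber t x)| =
  (\prod_k (N - (x k).+1)) ^ d.-1 * (N ^ d - \prod_k (N - (x k).+1)) ^ (n - d).
Proof.
move=> ht; rewrite card_familyE (bigID (mem (t @: setT))) /=; congr (_ * _).
- rewrite big_imset /=; last by move=> ? ? _ _; apply: ht.
  rewrite (eq_bigl xpredT); last by move=> k; rewrite inE.
  rewrite (eq_bigr (fun j => \prod_(k | k != j) (N - (x k).+1))); last by move=> j _; apply: card_fiber_named.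
  rewrite (exchange_big_dep xpredT) //= (big_morph (fun z => z ^ d.-1) (fun a b => expnMn a b _) (exp1n _)).
  apply: eq_bigr => k _; rewrite prod_nat_const; congr (_ ^ _).
  rewrite -[d in d.-1]card_ord -(cardC1 k); apply: eq_card => j; by rewrite !inE eq_sym.
- rewrite (eq_bigr (fun _ => N ^ d - \prod_k (N - (x k).+1))).
    rewrite prod_nat_const; congr (_ ^ _).
    have hc := cardC (mem (t @: setT)); rewrite card_ord (card_imset _ ht) cardsT card_ord in hc.
    by have := congr1 (subn^~ d) hc; rewrite /= addKn.
  move=> i hi; apply: card_fiber_other => j; apply: contraNneq hi => <-; exact: imset_f.
Qed.

Lemma strict_name_injective W t : strict_name W t -> injective t.
Proof.
case/andP=> /forallP h _ j k hjk; apply/eqP; apply: contraT => hne.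
by have /forallP/(_ k)/implyP := h j; rewrite eq_sym hne hjk ltnn => /(_ isT).
Qed.

Lemma sum_strict_name :
  \sum_t \sum_W strict_name W t =
  n ^_ d * \sum_(y : {ffun 'I_d -> 'I_N}) (\prod_k y k) ^ d.-1 * (N ^ d - \prod_k y k) ^ (n - d).
Proof.
pose q (x : {ffun 'I_d -> 'I_N}) := \prod_k (N - (x k).+1).
have h t : injective (t : {ffun 'I_d -> 'I_n}) ->
  \sum_W strict_name W t = \sum_x q x ^ d.-1 * (N ^ d - q x) ^ (n - d).
  move=> ht; rewrite (partition_big (fun W : {ffun 'I_n -> {ffun 'I_d -> 'I_N}} => [ffun k => W (t k) k]) xpredT) //=.
  apply: eq_bigr => x _; rewrite /q -(card_fiber x ht) -sum1_card big_mkcond [RHS]big_mkcond /=.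
  by apply: eq_bigr => W _; rewrite -(fiberP x W ht) andbC; case: eqP => _; case: (strict_name W t).
rewrite (bigID (fun t : {ffun 'I_d -> 'I_n} => injectiveb t)) /= [X in _ + X]big1 => [|t /injectiveP ht].
  rewrite addn0 (eq_bigr (fun _ => \sum_x q x ^ d.-1 * (N ^ d - q x) ^ (n - d))); last first.
    by move=> t /injectiveP; apply: h.
  rewrite big_const iter_addn_0 mulnC; congr (_ * _).
    have hi := card_inj_ffuns 'I_d 'I_n; rewrite !card_ord in hi.
    by rewrite -hi; apply: eq_card => t; rewrite !inE.
  (* Reversing each axis is the discrete form of y = 1 - x: the number of grid values above [x k]
     becomes the new coordinate. *)
  rewrite (reindex_inj (h := fun x : {ffun 'I_d -> 'I_N} => [ffun k => rev_ord (x k)])) /=.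
    apply: eq_bigr => x _; have -> // : q [ffun k => rev_ord (x k)] = \prod_k x k.
    apply: eq_bigr => k _; rewrite ffunE /= subnSK // subKn // ltnW //.
  by move=> x y /ffunP hxy; apply/ffunP => k; have := hxy k; rewrite !ffunE => /rev_ord_inj.
by rewrite big1 // => W _; case hs: (strict_name W t) => //; case: ht; apply: strict_name_injective hs.
Qed.
End Flatten.

(** * From natural-number counts to real averages *)

Lemma INR_ffact n d : INR (n ^_ d) = falling n d.
Proof. by elim: d => [|d IH] //=; rewrite ffactnSr -IH -mult_INR. Qed.

Lemma INR_expn k a : INR (k ^ a) = (INR k ^ a)%Re.
Proof. by elim: a => [|a IH] //; rewrite expnS mult_INR IH. Qed.

Lemma INR_sum_linear (T : finType) (s : T -> nat) (u : nat -> T -> nat) m (c : nat -> R) :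
  (forall y, INR (s y) = rsum m (fun i => Rmult (c i) (INR (u i y)))) ->
  INR (\sum_y s y) = rsum m (fun i => Rmult (c i) (INR (\sum_y u i y))).
Proof.
move=> h; rewrite unlock; elim: (index_enum T) => [|y e IH] /=.
- by rewrite (rsum_ext m _ (fun _ => 0%Re)) ?rsum_const ?Rmult_0_r // => k _; rewrite Rmult_0_r.
- rewrite plus_INR IH h -rsum_plus; apply: rsum_ext => k _; rewrite plus_INR; ring.
Qed.

Lemma sum_prod_pow N d a : \sum_(y : {ffun 'I_d -> 'I_N}) (\prod_k y k) ^ a = (\sum_(k < N) k ^ a) ^ d.
Proof.
rewrite -[d in RHS]card_ord -prod_nat_const bigA_distr_bigA /=.
by apply: eq_bigr => y _; rewrite (big_morph (fun z => z ^ a) (fun x y => expnMn x y _) (exp1n _)).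
Qed.

Lemma prod_le_pow N d (y : {ffun 'I_d -> 'I_N}) : \prod_k y k <= N ^ d.
Proof.
rewrite -[d in _ ^ d]card_ord -prod_nat_const; apply: leq_prod => k _; exact: ltnW.
Qed.

(** Monomials separate the coordinates: the sum of (prod y)^a over the grid is the d-th power of a
    one-dimensional power sum. The list of coefficients [b] is kept abstract, constrained only by
    the polynomial identity. *)
Lemma grid_sum_expansion N d m (b : nat -> R) : 0 < N -> 0 < d ->
  (forall y, (1 - y) ^ m = rsum m.+1 (fun i => b i * y ^ i))%Re ->
  (INR (\sum_(y : {ffun 'I_d -> 'I_N}) (\prod_k y k) ^ d.-1 * (N ^ d - \prod_k y k) ^ m)
   = INR N ^ (d * (d + m)) * rsum m.+1 (fun i => b i *
       (/ INR N ^ (S (d.-1 + i)) * rsum N (fun k => INR k ^ (d.-1 + i))) ^ d))%Re.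
Proof.
move=> /ltP hN hd hb; have hp := INR_gt0 _ hN.
have hpow k : Rlt 0 (INR N ^ k) by apply: pow_lt.
rewrite (@INR_sum_linear _ _ (fun i (y : {ffun 'I_d -> 'I_N}) => (\prod_k y k) ^ (d.-1 + i)) m.+1
  (fun i => (b i * (INR N ^ (d * m) / (INR N ^ d) ^ i))%Re)).
- rewrite -rsum_scal; apply: rsum_ext => i _.
  rewrite sum_prod_pow INR_expn -(rsum_INR N (fun k => k ^ (d.-1 + i))).
  rewrite (rsum_ext N (fun k => INR (k ^ (d.-1 + i))) (fun k => pow (INR k) (d.-1 + i))); last first.
    by move=> k _; rewrite INR_expn.
  rewrite Rpow_mult_distr pow_inv -!pow_mult.
  have e1 : (d * (d + m) = d * m + d * d)%coq_nat by rewrite !multE !plusE mulnDr addnC.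
  have e2 : ((d.-1 + i).+1 * d = d * d + d * i)%coq_nat by rewrite !multE !plusE -addSn prednK // mulnDl [i * d]mulnC.
  rewrite -multE -plusE e1 e2 !pow_add !multE; field; split; apply/Rgt_not_eq/hpow.
- move=> y; set P := \prod_k y k.
  rewrite mult_INR !INR_expn minus_INR; last by apply/leP/prod_le_pow.
  rewrite INR_expn.
  have -> : Rminus (INR N ^ d) (INR P) = Rmult (INR N ^ d) (1 - INR P / INR N ^ d)%Re.
    by field; apply/Rgt_not_eq/hpow.
  rewrite Rpow_mult_distr hb -pow_mult -!rsum_scal; apply: rsum_ext => i _.
  rewrite INR_expn -plusE pow_add /Rdiv Rpow_mult_distr pow_inv multE; ring.
Qed.
Lemma num_interior_generatorsE d n w : num_interior_generators d n w = INR (count_names d n w).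
Proof. by rewrite /num_interior_generators finite_card_generators. Qed.

Lemma num_interior_generators_bounded d n w :
  (Rabs (num_interior_generators d n w) <= INR n ^ d)%Re.
Proof.
rewrite num_interior_generatorsE Rabs_pos_eq; last exact: pos_INR.
rewrite -INR_expn; apply/le_INR/leP/count_names_le.
Qed.

Lemma gsum_generators_bounds N d m (b : nat -> R) : lt 0 N -> lt 0 d ->
  (forall y, (1 - y) ^ m = rsum m.+1 (fun i => b i * y ^ i))%Re ->
  let n := d + m in
  let A := gsum N (d * n) (num_interior_generators d n) in
  let T := Rmult (falling n d) (rsum m.+1 (fun i => b i *
       (/ INR N ^ (S (d.-1 + i)) * rsum N (fun k => INR k ^ (d.-1 + i))) ^ d)%Re) in
  (A <= T <= A + INR n ^ d * (1 - falling N (d * n) / INR N ^ (d * n)))%Re.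
Proof.
move=> /ltP hN /ltP hd hb n A T.
have hp : Rlt 0 (INR N ^ (d * n)) by apply: pow_lt; apply: INR_gt0; apply/ltP.
have hA : Rmult (INR N ^ (d * n)) A = INR (\sum_(f : {ffun 'I_(d * n) -> 'I_N}) count_names d n (grid_point f)).
  rewrite -gsum_grid_points // /A; congr (Rmult _ (gsum _ _ _)).
  by apply: functional_extensionality => w; exact: num_interior_generatorsE.
have hT : Rmult (INR N ^ (d * n)) T = INR (\sum_t \sum_(W : {ffun 'I_n -> {ffun 'I_d -> 'I_N}}) strict_name W t).
  rewrite sum_strict_name mult_INR INR_ffact /n addKn (grid_sum_expansion hN hd hb) /T.
  rewrite -/n; ring.
have /andP[/leP/le_INR h1 /leP/le_INR h2] := sum_count_names n hd hN.
have hff : N ^_ (d * n) <= N ^ (d * n).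
  by elim: (d * n) => // k IH; rewrite ffactnSr expnSr leq_mul // leq_subr.
rewrite -hA -hT in h1; rewrite plus_INR mult_INR minus_INR -?hA -?hT in h2; last exact/leP.
rewrite !INR_expn INR_ffact in h2.
split; first exact: Rmult_le_reg_l hp h1.
apply: (Rmult_le_reg_l _ _ _ hp); apply: Rle_trans h2 _; right.
by field; apply: Rgt_not_eq.
Qed.
End GridCount.

(** * The expectation as a limit of grid averages *)

Lemma num_interior_generators_invariant d n :
  order_invariant (d * n) (0 :: 1 :: nil) (num_interior_generators d n).
Proof.
intros w w' h. rewrite !GridCount.num_interior_generatorsE.
f_equal; apply GridCount.count_names_order; exact h.
Qed.

Lemma is_lim_seq_rsum m (u : nat -> nat -> R) (l : nat -> R) :
  (forall i, is_lim_seq (u i) (Finite (l i))) ->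
  is_lim_seq (fun N => rsum m (fun i => u i N)) (Finite (rsum m l)).
Proof.
intros h; induction m as [|m IH]; simpl; [apply is_lim_seq_const|].
apply is_lim_seq_plus'; auto.
Qed.

Lemma is_lim_seq_pow u l k : is_lim_seq u (Finite l) -> is_lim_seq (fun N => u N ^ k) (Finite (l ^ k)).
Proof.
intros h; induction k as [|k IH]; simpl; [apply is_lim_seq_const|].
apply is_lim_seq_mult'; assumption.
Qed.

(** [/ INR (d + i)] is the integral of y^(d-1+i) over [0,1], one factor for each of the d
    coordinates. The tie correction is O(1/N) by [falling_ratio] applied to the grid size. *)
Lemma generators_grid_limit d m b : (1 <= d)%nat ->
  (forall y, (1 - y) ^ m = rsum (S m) (fun i => b i * y ^ i)) ->
  is_lim_seq (fun N => gsum (S N) (d * (d + m)) (num_interior_generators d (d + m)))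
    (Finite (falling (d + m) d * rsum (S m) (fun i => b i * (/ INR (d + i)) ^ d))).
Proof.
intros hd hb. set (n := (d + m)%nat).
set (T := fun N => falling n d * rsum (S m) (fun i => b i *
       (/ INR N ^ (S (pred d + i)) * rsum N (fun k => INR k ^ (pred d + i))) ^ d)).
set (A := fun N => gsum N (d * n) (num_interior_generators d n)).
assert (hT : is_lim_seq (fun N => T (S N))
    (Finite (falling n d * rsum (S m) (fun i => b i * (/ INR (d + i)) ^ d)))).
{ apply is_lim_seq_mult'; [apply is_lim_seq_const|].
  apply (is_lim_seq_rsum (S m) (fun i N => b i *
       (/ INR (S N) ^ (S (pred d + i)) * rsum (S N) (fun k => INR k ^ (pred d + i))) ^ d)).
  intros i. apply is_lim_seq_mult'; [apply is_lim_seq_const|]. apply is_lim_seq_pow.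
  replace (d + i)%nat with (S (pred d + i)) by lia. apply power_sum_limit. }
assert (hD : is_lim_seq (fun N => A (S N) - T (S N)) (Finite 0)).
{ apply (is_lim_seq_rate (fun N => A N - T N) 0 (INR n ^ d * INR (d * n) ^ 2)).
  intros N hN. rewrite Rminus_0_r.
  assert (h := @GridCount.gsum_generators_bounds _ _ _ _ hN hd hb).
  cbv zeta in h. 
  change (A N <= T N <= A N + INR n ^ d * (1 - falling N (d * n) / INR N ^ (d * n))) in h.
  destruct (falling_ratio N (d * n) hN) as [_ [h1 _]].
  assert (hb' : INR n ^ d * (1 - falling N (d * n) / INR N ^ (d * n)) <= INR n ^ d * (INR (d * n) ^ 2 / INR N)).
  { apply Rmult_le_compat_l; [apply pow_le, pos_INR|lra]. }
  unfold Rdiv in *. rewrite Rmult_assoc. apply Rabs_le; lra. }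
apply is_lim_seq_ext with (fun N => (A (S N) - T (S N)) + T (S N)); [intros; unfold A; ring|].
match goal with |- is_lim_seq _ (Finite ?x) => replace x with (0 + x) by ring end.
apply is_lim_seq_plus'; assumption.
Qed.

(** * Integrals over the line and moments of the Gamma integrand *)

Lemma exp_mono x y : x <= y -> exp x <= exp y.
Proof. intros [h| ->]; [left; apply exp_increasing; exact h|apply Rle_refl]. Qed.

(** The logistic function of a v, divided by a and shifted. Its derivative is smooth, even and
    comparable to e^(-a|v|), so estimates against that kernel need no splitting of integrals at
    0. *)
Definition logistic (a v : R) : R := - / (a * (1 + exp (a * v))).

Lemma is_derive_logistic a v : 0 < a ->
  is_derive (logistic a) v (exp (a * v) / (1 + exp (a * v)) ^ 2).
Proof.
intros ha; unfold logistic; pose proof (exp_pos (a * v)) as he.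
auto_derive.
- apply Rgt_not_eq, Rmult_lt_0_compat; lra.
- field; lra.
Qed.

Lemma exp_abs_le_logistic a v : 0 < a -> exp (- (a * Rabs v)) <= 4 * (exp (a * v) / (1 + exp (a * v)) ^ 2).
Proof.
intros ha.
(* The factor 4 bounds (1 + e)^2 for e <= 1; evenness reduces every v to this case. *)
assert (h : forall e, 0 < e <= 1 -> e <= 4 * (e / (1 + e) ^ 2)).
{ intros e he. replace (4 * (e / (1 + e) ^ 2)) with (e * 4 / (1 + e) ^ 2) by (field; lra).
  apply Rle_div_r; [apply Rlt_gt, pow_lt; lra|]. apply Rmult_le_compat_l; [lra|]. nra. }
assert (hsym : forall x, exp x / (1 + exp x) ^ 2 = exp (- x) / (1 + exp (- x)) ^ 2).
{ intros x; rewrite exp_Ropp. pose proof (exp_pos x). field; lra. }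
assert (hc : exp (a * v) / (1 + exp (a * v)) ^ 2 = exp (- (a * Rabs v)) / (1 + exp (- (a * Rabs v))) ^ 2).
{ unfold Rabs; destruct Rcase_abs.
  - replace (- (a * - v)) with (a * v) by ring; reflexivity.
  - apply hsym. }
rewrite hc. apply h; split; [apply exp_pos|]. rewrite <- exp_0; apply exp_mono.
assert (0 <= a * Rabs v) by (apply Rmult_le_pos; [lra|apply Rabs_pos]). lra.
Qed.

Lemma RInt_exp_abs_bound (f : R -> R) C a x y : 0 < a -> x <= y -> (forall v, continuous f v) ->
  (forall v, x <= v <= y -> Rabs (f v) <= C * exp (- (a * Rabs v))) ->
  Rabs (RInt f x y) <= 4 * C * (logistic a y - logistic a x).
Proof.
intros ha hxy hf hb.
assert (hC : 0 <= C).
{ specialize (hb x ltac:(lra)). pose proof (Rabs_pos (f x)). pose proof (exp_pos (- (a * Rabs x))). nra. }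
assert (hI : is_RInt (fun v => 4 * C * (exp (a * v) / (1 + exp (a * v)) ^ 2)) x y
  (4 * C * (logistic a y - logistic a x))).
{ apply (is_RInt_scal (fun v => exp (a * v) / (1 + exp (a * v)) ^ 2) x y (4 * C)).
  apply (is_RInt_derive (logistic a)).
  - intros v _; apply is_derive_logistic; exact ha.
  - intros v _. apply (ex_derive_continuous (fun v => exp (a * v) / (1 + exp (a * v)) ^ 2)).
    auto_derive. pose proof (exp_pos (a * v)). apply Rgt_not_eq; repeat apply Rmult_lt_0_compat; lra. }
rewrite <- (is_RInt_unique _ _ _ _ hI).
eapply Rle_trans; [apply abs_RInt_le; [exact hxy|]|].
- apply @ex_RInt_continuous; intros; apply hf.
- apply RInt_le; [exact hxy| |eexists; exact hI|].
  + apply @ex_RInt_continuous; intros z _. apply (continuous_comp f Rabs); [apply hf|apply continuous_Rabs].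
  + intros v hv. eapply Rle_trans; [apply hb; lra|].
    pose proof (exp_abs_le_logistic a v ha). apply (Rmult_le_compat_l C) in H; lra.
Qed.

Lemma logistic_increment a x y : 0 < a -> logistic a y - logistic a x <= / a.
Proof.
intros ha. unfold logistic. pose proof (exp_pos (a * x)) as hx; pose proof (exp_pos (a * y)) as hy.
assert (0 < / (a * (1 + exp (a * y)))) by (apply Rinv_0_lt_compat, Rmult_lt_0_compat; lra).
assert (/ (a * (1 + exp (a * x))) <= / a); [|lra].
apply Rinv_le_contravar; [lra|]. nra.
Qed.

(** The true decay is exponential, but the rate 1/x, immediate from e^z >= 1 + z, already yields
    Cauchy sequences. *)
Lemma logistic_tail a x : 0 < a -> 0 < x ->
  - logistic a x <= / (a ^ 2 * x) /\ logistic a (- x) + / a <= / (a ^ 2 * x).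
Proof.
intros ha hx.
assert (hax : 0 < a * x) by (apply Rmult_lt_0_compat; lra).
pose proof (exp_ineq1_le (a * x)) as he. pose proof (exp_pos (a * x)).
assert (h : / (a * (1 + exp (a * x))) <= / (a ^ 2 * x)).
{ apply Rinv_le_contravar; [simpl; nra|]. simpl. nra. }
unfold logistic; split; [lra|].
replace (a * - x) with (- (a * x)) by ring. rewrite exp_Ropp.
replace (- / (a * (1 + / exp (a * x))) + / a) with (/ (a * (1 + exp (a * x)))); [exact h|].
field; lra.
Qed.

(** Symmetric integer windows reduce everything to limits of sequences. For continuous [dominated]
    integrands this is the usual improper integral. *)
Definition line_int (f : R -> R) (v : R) : Prop :=
  is_lim_seq (fun k => RInt f (- INR k) (INR k)) (Finite v).

Definition dominated (f : R -> R) : Prop :=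
  exists C a, 0 < a /\ forall v, Rabs (f v) <= C * exp (- (a * Rabs v)).

Lemma line_int_bound (f : R -> R) C a l : 0 < a -> (forall v, continuous f v) ->
  (forall v, Rabs (f v) <= C * exp (- (a * Rabs v))) -> line_int f l -> Rabs l <= 4 * C / a.
Proof.
intros ha hf hb hl.
assert (hC : 0 <= C).
{ specialize (hb 0). pose proof (Rabs_pos (f 0)). pose proof (exp_pos (- (a * Rabs 0))). nra. }
apply (is_lim_seq_le (fun k => Rabs (RInt f (- INR k) (INR k))) (fun _ => 4 * C / a) (Finite (Rabs l)) (Finite (4 * C / a))).
- intros k. pose proof (pos_INR k).
  eapply Rle_trans; [apply (RInt_exp_abs_bound f C a); auto; lra|].
  apply Rmult_le_compat_l; [lra|]. apply logistic_increment; exact ha.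
- apply (is_lim_seq_abs _ (Finite l)); exact hl.
- apply is_lim_seq_const.
Qed.

Lemma line_int_ex (f : R -> R) : (forall v, continuous f v) -> dominated f -> exists l, line_int f l.
Proof.
intros hf [C [a [ha hb]]].
assert (hC : 0 <= C).
{ specialize (hb 0). pose proof (Rabs_pos (f 0)). pose proof (exp_pos (- (a * Rabs 0))). nra. }
assert (hex : forall x y, ex_RInt f x y) by (intros; apply @ex_RInt_continuous; intros; apply hf).
(* Enlarging the window adds two tails, each at most 4C times an increment of [logistic a] bounded
   by 1/(a^2 n). *)
assert (hstep : forall n m, (0 < n)%nat -> (n <= m)%nat ->
  Rabs (RInt f (- INR m) (INR m) - RInt f (- INR n) (INR n)) <= 8 * C / a ^ 2 / INR n).
{ intros n m hn hnm. apply INR_gt0 in hn. apply le_INR in hnm.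
  assert (e : RInt f (- INR m) (INR m) =
    RInt f (- INR m) (- INR n) + (RInt f (- INR n) (INR n) + RInt f (INR n) (INR m))).
  { rewrite <- (RInt_Chasles f (- INR m) (- INR n) (INR m)) by apply hex.
    rewrite <- (RInt_Chasles f (- INR n) (INR n) (INR m)) by apply hex. reflexivity. }
  rewrite e.
  match goal with |- Rabs ?e <= _ => replace e with (RInt f (- INR m) (- INR n) + RInt f (INR n) (INR m)) by ring end.
  eapply Rle_trans; [apply Rabs_triang|].
  pose proof (RInt_exp_abs_bound f C a (- INR m) (- INR n) ha ltac:(lra) hf (fun v _ => hb v)) as h1.
  pose proof (RInt_exp_abs_bound f C a (INR n) (INR m) ha ltac:(lra) hf (fun v _ => hb v)) as h2.
  destruct (logistic_tail a (INR n) ha hn) as [t1 t2].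
  assert (t3 : logistic a (INR m) <= 0).
  { unfold logistic. pose proof (exp_pos (a * INR m)).
    assert (0 < / (a * (1 + exp (a * INR m)))) by (apply Rinv_0_lt_compat, Rmult_lt_0_compat; lra). lra. }
  assert (t4 : - logistic a (- INR m) <= / a).
  { unfold logistic. rewrite Ropp_involutive. pose proof (exp_pos (a * - INR m)).
    apply Rinv_le_contravar; [lra|nra]. }
  replace (8 * C / a ^ 2 / INR n) with (4 * C * (/ (a ^ 2 * INR n)) + 4 * C * (/ (a ^ 2 * INR n))) by (field; lra).
  apply Rplus_le_compat; (eapply Rle_trans; [eassumption|]); apply Rmult_le_compat_l; lra. }
assert (hcv : ex_finite_lim_seq (fun k => RInt f (- INR k) (INR k))).
{ apply ex_lim_seq_cauchy_corr. intros eps.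
  destruct (nfloor_ex (8 * C / a ^ 2 / eps)) as [N hN].
  { apply Rmult_le_pos; [|left; apply Rinv_0_lt_compat, cond_pos].
    apply Rmult_le_pos; [lra|left; apply Rinv_0_lt_compat, pow_lt; lra]. }
  assert (hkey : forall n, (S N <= n)%nat -> 8 * C / a ^ 2 / INR n < eps).
  { intros n hn. pose proof (cond_pos eps). pose proof (INR_gt0 n ltac:(lia)).
    apply Rlt_div_l; [lra|]. destruct hN as [_ hN]. apply Rlt_div_l in hN; [|lra].
    apply le_INR in hn. rewrite S_INR in hn. nra. }
  exists (S N); intros n m hn hm.
  destruct (le_lt_dec n m) as [h|h].
  - rewrite Rabs_minus_sym. eapply Rle_lt_trans; [apply hstep; lia|]. apply hkey; exact hn.
  - eapply Rle_lt_trans; [apply hstep; lia|]. apply hkey; exact hm. }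
destruct hcv as [l hl]; exists l; exact hl.
Qed.

Lemma line_int_plus (f g : R -> R) l l' : (forall v, continuous f v) -> (forall v, continuous g v) ->
  line_int f l -> line_int g l' -> line_int (fun v => f v + g v) (l + l').
Proof.
intros hf hg h1 h2. unfold line_int.
apply is_lim_seq_ext with (fun k => RInt f (- INR k) (INR k) + RInt g (- INR k) (INR k)).
- intros k. symmetry. apply (RInt_plus f g); apply @ex_RInt_continuous; intros; auto.
- apply is_lim_seq_plus'; assumption.
Qed.

Lemma line_int_scal (f : R -> R) l c : (forall v, continuous f v) -> line_int f l -> line_int (fun v => c * f v) (c * l).
Proof.
intros hf h1. unfold line_int.
apply is_lim_seq_ext with (fun k => c * RInt f (- INR k) (INR k)).
- intros k. symmetry. apply (RInt_scal f); apply @ex_RInt_continuous; intros; auto.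
- apply is_lim_seq_mult'; [apply is_lim_seq_const|assumption].
Qed.

Lemma continuous_rsum m (f : nat -> R -> R) v : (forall i, continuous (f i) v) ->
  continuous (fun v => rsum m (fun i => f i v)) v.
Proof.
intros h; induction m as [|m IH]; simpl; [apply continuous_const|].
apply (continuous_plus (fun v => rsum m (fun i => f i v)) (f m)); auto.
Qed.

Lemma line_int_rsum m (f : nat -> R -> R) (l : nat -> R) : (forall i v, continuous (f i) v) ->
  (forall i, line_int (f i) (l i)) -> line_int (fun v => rsum m (fun i => f i v)) (rsum m l).
Proof.
intros hf h; induction m as [|m IH]; simpl.
- unfold line_int. apply is_lim_seq_ext with (fun _ => 0); [|apply is_lim_seq_const].
  intros k. rewrite RInt_const. unfold scal; simpl; unfold mult; simpl; ring.
- apply (line_int_plus (fun v => rsum m (fun i => f i v)) (f m)); auto.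
  intros v; apply continuous_rsum; auto.
Qed.

Lemma line_int_unique f l l' : line_int f l -> line_int f l' -> l = l'.
Proof.
intros h1 h2. apply is_lim_seq_unique in h1. apply is_lim_seq_unique in h2.
rewrite h1 in h2; injection h2; auto.
Qed.

Lemma pow_le_exp j a : 0 < a -> exists C, 0 < C /\ forall y, 0 <= y -> y ^ j <= C * exp (a * y).
Proof.
revert a; induction j as [|j IH]; intros a ha.
- exists 1; split; [lra|]. intros y hy; simpl. rewrite Rmult_1_l, <- exp_0. apply exp_mono. nra.
- destruct (IH (a / 2) ltac:(lra)) as [C [hC h]]. exists (C * (2 / a)).
  split; [apply Rmult_lt_0_compat; [lra|apply Rdiv_lt_0_compat; lra]|].
  intros y hy. specialize (h y hy).
  replace (a * y) with (a / 2 * y + a / 2 * y) by field. rewrite exp_plus.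
  pose proof (exp_ineq1_le (a / 2 * y)) as he.
  assert (hy' : y <= 2 / a * exp (a / 2 * y)).
  { replace y with (2 / a * (a / 2 * y)) at 1 by (field; lra).
    apply Rmult_le_compat_l; [left; apply Rdiv_lt_0_compat; lra|lra]. }
  simpl. replace (C * (2 / a) * (exp (a / 2 * y) * exp (a / 2 * y)))
    with ((2 / a * exp (a / 2 * y)) * (C * exp (a / 2 * y))) by ring.
  apply Rmult_le_compat; auto. apply pow_le; exact hy.
Qed.

Lemma dominated_le f g : dominated g -> (forall v, Rabs (f v) <= Rabs (g v)) -> dominated f.
Proof.
intros [C [a [ha h]]] hfg; exists C, a; split; [exact ha|].
intros v; eapply Rle_trans; [apply hfg|apply h].
Qed.

Lemma dominated_plus f g : dominated f -> dominated g -> dominated (fun v => f v + g v).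
Proof.
intros [C [a [ha h]]] [C' [a' [ha' h']]].
assert (hC : forall C b (f : R -> R), (forall v, Rabs (f v) <= C * exp (- (b * Rabs v))) -> 0 <= C).
{ intros C0 b f0 hb. specialize (hb 0). pose proof (Rabs_pos (f0 0)). pose proof (exp_pos (- (b * Rabs 0))). nra. }
exists (C + C'), (Rmin a a'); split; [apply Rmin_glb_lt; assumption|].
intros v. eapply Rle_trans; [apply Rabs_triang|].
rewrite Rmult_plus_distr_r.
assert (hm : forall b, Rmin a a' <= b -> exp (- (b * Rabs v)) <= exp (- (Rmin a a' * Rabs v))).
{ intros b hb. apply exp_mono, Ropp_le_contravar, Rmult_le_compat_r; [apply Rabs_pos|exact hb]. }
apply Rplus_le_compat.
- eapply Rle_trans; [apply h|]. apply Rmult_le_compat_l; [eapply hC; exact h|]. apply hm, Rmin_l.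
- eapply Rle_trans; [apply h'|]. apply Rmult_le_compat_l; [eapply hC; exact h'|]. apply hm, Rmin_r.
Qed.

Lemma dominated_mult_pow f j : dominated f -> dominated (fun v => (1 + Rabs v) ^ j * f v).
Proof.
intros [C [a [ha h]]].
destruct (pow_le_exp j (a / 2) ltac:(lra)) as [K [hK hp]].
exists (K * exp (a / 2) * C), (a / 2); split; [lra|]. intros v.
pose proof (Rabs_pos v) as hv.
assert (h0 : 0 <= (1 + Rabs v) ^ j) by (apply pow_le; lra).
rewrite Rabs_mult, (Rabs_pos_eq _ h0).
replace (K * exp (a / 2) * C * exp (- (a / 2 * Rabs v)))
  with (K * exp (a / 2 * (1 + Rabs v)) * (C * exp (- (a * Rabs v)))).
- apply Rmult_le_compat; auto; [apply Rabs_pos|]. apply hp; lra.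
- replace (- (a / 2 * Rabs v)) with (a / 2 * Rabs v + - (a * Rabs v)) by field.
  rewrite exp_plus. replace (a / 2 * (1 + Rabs v)) with (a / 2 + a / 2 * Rabs v) by ring.
  rewrite (exp_plus (a / 2)). ring.
Qed.

Lemma dominated_exp_exp x : 0 < x -> dominated (fun v => exp (x * v - exp v)).
Proof.
(* For v >= 0, e^v >= v^2/4, and 4x^2 is the maximum of 2xv - v^2/4; for v < 0 the term xv is
   already -x|v|. *)
intros hx; exists (exp (4 * x ^ 2)), x; split; [exact hx|]. intros v.
rewrite Rabs_pos_eq by (left; apply exp_pos). rewrite <- exp_plus. apply exp_mono.
pose proof (exp_pos v) as he.
pose proof (pow2_ge_0 x) as hx2.
unfold Rabs; destruct Rcase_abs as [h|h]; [lra|].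
assert (hq : v ^ 2 / 4 <= exp v).
{ replace v with (v / 2 + v / 2) at 2 by field. rewrite exp_plus.
  pose proof (exp_ineq1_le (v / 2)). nra. }
pose proof (pow2_ge_0 (v / 2 - 2 * x)). nra.
Qed.

(** The j-th derivative in x of t^(x-1) e^(-t) dt after the substitution t = e^v. *)
Definition gamma_integrand (j : nat) (x v : R) : R := v ^ j * exp (x * v - exp v).

Lemma gamma_integrand_continuous j x v : continuous (gamma_integrand j x) v.
Proof.
apply (ex_derive_continuous (gamma_integrand j x)). unfold gamma_integrand; auto_derive; auto.
Qed.

Lemma gamma_integrand_dominated j x : 0 < x -> dominated (gamma_integrand j x).
Proof.
intros hx. eapply dominated_le; [apply (dominated_mult_pow _ j (dominated_exp_exp x hx))|].
intros v. unfold gamma_integrand. rewrite !Rabs_mult. apply Rmult_le_compat_r; [apply Rabs_pos|].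
pose proof (Rabs_pos v). rewrite <- !RPow_abs. rewrite (Rabs_pos_eq (1 + Rabs v)) by lra.
apply pow_incr; lra.
Qed.

Lemma gamma_moments_ex : exists G : nat -> R -> R, forall j x, 0 < x -> line_int (gamma_integrand j x) (G j x).
Proof.
assert (h : forall p : nat * R, exists l, 0 < snd p -> line_int (gamma_integrand (fst p) (snd p)) l).
{ intros [j x]; simpl. destruct (Rlt_dec 0 x) as [hx|hx]; [|exists 0; tauto].
  destruct (line_int_ex (gamma_integrand j x)) as [l hl].
  - intros; apply gamma_integrand_continuous.
  - apply gamma_integrand_dominated; exact hx.
  - exists l; auto. }
destruct (choice _ h) as [G hG]. exists (fun j x => G (j, x)). intros j x hx; apply (hG (j, x)); exact hx.
Qed.

(** From 1 - z <= e^(-z) one gets e^z - 1 - z <= z (e^z - 1), so e^z >= 1 + z suffices at the price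
    of the factor 1/2. *)
Lemma exp_taylor2 z : Rabs (exp z - 1 - z) <= z ^ 2 * exp (Rabs z).
Proof.
pose proof (exp_ineq1_le z) as h1. pose proof (exp_ineq1_le (- z)) as h2.
pose proof (exp_pos z) as h3.
assert (h4 : exp z - 1 <= z * exp z).
{ rewrite exp_Ropp in h2. assert (exp z * (1 + - z) <= exp z * / exp z) by (apply Rmult_le_compat_l; lra).
  rewrite Rinv_r in H by lra. lra. }
rewrite Rabs_pos_eq by lra.
unfold Rabs; destruct Rcase_abs as [h|h].
- assert (1 <= exp (- z)) by lra. nra.
- nra.
Qed.

Lemma gamma_moments_derivative G : (forall j x, 0 < x -> line_int (gamma_integrand j x) (G j x)) ->
  forall j x, 0 < x -> derivable_pt_lim (G j) x (G (S j) x).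
Proof.
intros hG j x hx.
(* One majorant for all |h| <= x/2: the quadratic remainder raises the power of v to j + 2, and its
   factor e^(|hv|) is absorbed by shifting x to x + x/2 or x - x/2 according to the sign of v. *)
set (W := fun v => (1 + Rabs v) ^ (j + 2) * (exp ((x + x / 2) * v - exp v) + exp ((x - x / 2) * v - exp v))).
assert (hW : dominated W).
{ apply dominated_mult_pow, dominated_plus; apply dominated_exp_exp; lra. }
destruct hW as [C [a [ha hW]]].
assert (hC : 0 <= C).
{ specialize (hW 0). pose proof (Rabs_pos (W 0)). pose proof (exp_pos (- (a * Rabs 0))). nra. }
set (K := 4 * C / a).
assert (hK : 0 <= K) by (apply Rmult_le_pos; [lra|left; apply Rinv_0_lt_compat; lra]).
assert (hrem : forall h, Rabs h <= x / 2 -> Rabs (G j (x + h) - G j x - h * G (S j) x) <= h ^ 2 * K).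
{ intros h hh. pose proof hh as hh'. apply Rabs_le_between in hh'.
  replace (h ^ 2 * K) with (4 * (h ^ 2 * C) / a) by (unfold K; field; lra).
  apply (line_int_bound (fun v => (gamma_integrand j (x + h) v + (-1) * gamma_integrand j x v) + (- h) * gamma_integrand (S j) x v) (h ^ 2 * C) a); [exact ha| | |].
  - intros v. apply (ex_derive_continuous (fun v => (gamma_integrand j (x + h) v + (-1) * gamma_integrand j x v) + (- h) * gamma_integrand (S j) x v)).
    unfold gamma_integrand; auto_derive; auto.
  - intros v. rewrite Rmult_assoc.
    apply Rle_trans with (h ^ 2 * Rabs (W v)); [|apply Rmult_le_compat_l; [apply pow2_ge_0|apply hW]].
    unfold gamma_integrand.
    replace (v ^ j * exp ((x + h) * v - exp v) + -1 * (v ^ j * exp (x * v - exp v)) + - h * (v ^ S j * exp (x * v - exp v)))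
      with (v ^ j * exp (x * v - exp v) * (exp (h * v) - 1 - h * v)).
    2:{ replace ((x + h) * v - exp v) with ((x * v - exp v) + h * v) by ring. rewrite exp_plus. simpl; ring. }
    pose proof (exp_pos (x * v - exp v)) as he.
    pose proof (Rabs_pos v) as hv.
    rewrite !Rabs_mult, (Rabs_pos_eq (exp _)) by lra. rewrite <- RPow_abs.
    assert (hw : Rabs (W v) = W v).
    { apply Rabs_pos_eq. unfold W. apply Rmult_le_pos; [apply pow_le; lra|].
      pose proof (exp_pos ((x + x / 2) * v - exp v)); pose proof (exp_pos ((x - x / 2) * v - exp v)); lra. }
    rewrite hw.
    apply Rle_trans with (Rabs v ^ j * exp (x * v - exp v) * ((h * v) ^ 2 * exp (Rabs (h * v)))).
    { apply Rmult_le_compat_l; [apply Rmult_le_pos; [apply pow_le; lra|lra]|apply exp_taylor2]. }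
    assert (hv2 : v ^ 2 = Rabs v ^ 2) by (rewrite <- (pow2_abs v); reflexivity).
    replace (Rabs v ^ j * exp (x * v - exp v) * ((h * v) ^ 2 * exp (Rabs (h * v))))
      with (h ^ 2 * (Rabs v ^ (j + 2) * (exp (x * v - exp v) * exp (Rabs (h * v))))).
    2:{ rewrite Rpow_mult_distr, hv2, pow_add. ring. }
    apply Rmult_le_compat_l; [apply pow2_ge_0|]. unfold W.
    apply Rmult_le_compat.
    + apply pow_le; lra.
    + left; apply Rmult_lt_0_compat; apply exp_pos.
    + apply pow_incr; lra.
    + rewrite <- exp_plus.
      assert (hav : Rabs (h * v) <= x / 2 * Rabs v) by (rewrite Rabs_mult; apply Rmult_le_compat_r; lra).
      apply Rle_trans with (exp (x * v - exp v + x / 2 * Rabs v)); [apply exp_mono; lra|].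
      pose proof (exp_pos ((x + x / 2) * v - exp v)); pose proof (exp_pos ((x - x / 2) * v - exp v)).
      unfold Rabs; destruct Rcase_abs.
      * replace (x * v - exp v + x / 2 * - v) with ((x - x / 2) * v - exp v) by field; lra.
      * replace (x * v - exp v + x / 2 * v) with ((x + x / 2) * v - exp v) by field; lra.
  - replace (G j (x + h) - G j x - h * G (S j) x) with ((G j (x + h) + (-1) * G j x) + (- h) * G (S j) x) by ring.
    assert (hc : forall i z v, continuous (gamma_integrand i z) v) by (intros; apply gamma_integrand_continuous).
    apply (line_int_plus (fun v => gamma_integrand j (x + h) v + (-1) * gamma_integrand j x v) (fun v => (- h) * gamma_integrand (S j) x v)).
    + intros v; apply (continuous_plus (gamma_integrand j (x + h)) (fun v => (-1) * gamma_integrand j x v)); [apply hc|].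
      apply (continuous_scal_r (-1) (gamma_integrand j x)); apply hc.
    + intros v; apply (continuous_scal_r (- h) (gamma_integrand (S j) x)); apply hc.
    + apply line_int_plus; [intros; apply hc| |apply hG; lra|].
      * intros v; apply (continuous_scal_r (-1) (gamma_integrand j x)); apply hc.
      * apply line_int_scal; [intros; apply hc|apply hG; lra].
    + apply line_int_scal; [intros; apply hc|apply hG; lra]. }
intros eps heps.
assert (hd : 0 < Rmin (x / 2) (eps / (K + 1))).
{ apply Rmin_glb_lt; [lra|apply Rdiv_lt_0_compat; lra]. }
exists (mkposreal _ hd); intros h hne hlt; simpl in hlt.
assert (h1 : Rabs h < x / 2) by (eapply Rlt_le_trans; [exact hlt|apply Rmin_l]).
assert (h2 : Rabs h < eps / (K + 1)) by (eapply Rlt_le_trans; [exact hlt|apply Rmin_r]).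
replace ((G j (x + h) - G j x) / h - G (S j) x) with ((G j (x + h) - G j x - h * G (S j) x) / h) by (field; exact hne).
pose proof (Rabs_pos_lt h hne) as hh.
unfold Rdiv. rewrite Rabs_mult, Rabs_inv.
apply Rle_lt_trans with (h ^ 2 * K * / Rabs h).
- apply Rmult_le_compat_r; [left; apply Rinv_0_lt_compat; lra|]. apply hrem; lra.
- rewrite <- (pow2_abs h). replace (Rabs h ^ 2 * K * / Rabs h) with (Rabs h * K) by (field; lra).
  apply Rlt_div_r in h2; [|lra]. nra.
Qed.

(** * Asymptotics *)

Lemma is_Gamma_line_int x v : is_Gamma x v -> line_int (gamma_integrand 0 x) v.
Proof.
intros h. unfold line_int.
assert (hsub : forall k, RInt (gamma_integrand 0 x) (- INR k) (INR k) =
  RInt (fun t => Rpower t (x - 1) * exp (- t)) (exp (- INR k)) (exp (INR k))).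
{ intros k.
  rewrite <- (RInt_comp (fun t => Rpower t (x - 1) * exp (- t)) exp exp).
  - apply RInt_ext. intros u _. unfold gamma_integrand, scal; simpl; unfold mult; simpl.
    unfold Rpower. rewrite ln_exp, Rmult_1_l, <- !exp_plus. f_equal; ring.
  - intros u _. apply (ex_derive_continuous (fun t => Rpower t (x - 1) * exp (- t))).
    unfold Rpower. auto_derive. apply exp_pos.
  - intros u _. split; [apply is_derive_exp|].
    apply (ex_derive_continuous exp). exists (exp u); apply is_derive_exp. }
apply is_lim_seq_spec. intros eps.
destruct (h (eps / 2)) as [delta [M [hd hM]]]; [apply Rlt_gt; pose proof (cond_pos eps); lra|].
assert (hk : exists K, forall k, (K <= k)%nat -> exp (- INR k) < delta /\ M < exp (INR k)).
{ destruct (nfloor_ex (Rmax 0 M)) as [K1 hK1]; [apply Rmax_l|].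
  destruct (nfloor_ex (/ delta)) as [K2 hK2]; [left; apply Rinv_0_lt_compat; lra|].
  exists (S (K1 + K2)). intros k hk. apply le_INR in hk. rewrite S_INR, plus_INR in hk.
  pose proof (pos_INR K1); pose proof (pos_INR K2). pose proof (Rmax_r 0 M).
  pose proof (exp_ineq1_le (INR k)). split; [|lra].
  rewrite exp_Ropp. rewrite <- (Rinv_inv delta).
  apply Rinv_lt_contravar; [|lra]. apply Rmult_lt_0_compat; [apply Rinv_0_lt_compat|]; lra. }
destruct hk as [K hK]. exists K; intros k hk. destruct (hK k hk) as [h1 h2].
destruct (hM (exp (- INR k)) (exp (INR k))) as [pr hpr]; [split; [apply exp_pos|exact h1]|exact h2|].
rewrite hsub, (RInt_Reals _ _ _ pr). pose proof (cond_pos eps). lra.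
Qed.

Lemma derivs_are_gamma_moments Gam D G :
  (forall x, 0 < x -> is_Gamma x (Gam x)) -> are_derivs_on_pos Gam D ->
  (forall j x, 0 < x -> line_int (gamma_integrand j x) (G j x)) ->
  forall j x, 0 < x -> D j x = G j x.
Proof.
intros hGam [h0 hS] hG j; induction j as [|j IH]; intros x hx.
- rewrite h0 by exact hx. apply (line_int_unique (gamma_integrand 0 x)); [|apply hG; exact hx].
  apply is_Gamma_line_int, hGam, hx.
- pose proof (hS j x hx) as h1. pose proof (gamma_moments_derivative G hG j x hx) as h2.
  apply is_derive_Reals in h1. apply is_derive_Reals in h2.
  apply (is_derive_ext_loc (D j) (G j)) in h1.
  + apply is_derive_unique in h1. apply is_derive_unique in h2. congruence.
  (* The ball of radius x around x stays among the positive reals, the only place where the two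
     functions are known to agree. *)
  + exists (mkposreal x hx). intros y hy. apply IH.
    unfold ball in hy; simpl in hy; unfold AbsRing_ball, abs, minus, plus, opp in hy; simpl in hy.
    apply Rabs_lt_between in hy. lra.
Qed.

(** In the constant, d^2 is the loss in rho. Since u <= 1, using the exponent m = n - d in place of
    n costs a factor e^d, and e^(d+1) where the difference of m-th powers leaves m - 1. The last
    summand comes from e^(du) - 1 <= d u e^d. The weights 1, t^2 and t that accompany the three
    errors are all at most (1 + t)^2. *)
Lemma binomial_kernel_approx n m d u rho t : (n = m + d)%nat -> (1 <= m)%nat ->
  0 <= u <= 1 -> t = INR n * u -> 1 - INR d ^ 2 / INR n <= rho <= 1 ->
  Rabs (rho * (1 - u) ^ m - exp (- t)) <=
  (INR d ^ 2 * exp (INR d) + exp (INR d + 1) + INR d * exp (INR d)) / INR n * ((1 + t) ^ 2 * exp (- t)).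
Proof.
intros hn hm hu ht hrho.
assert (hn1 : 1 <= INR n) by (apply (le_INR 1); lia).
assert (hdn : INR n = INR m + INR d) by (rewrite hn, plus_INR; reflexivity).
pose proof (pos_INR d) as hd. pose proof (pos_INR m) as hm0.
pose proof (Rinv_0_lt_compat (INR n) ltac:(lra)) as hin.
pose proof (exp_pos (- t)) as het. pose proof (exp_pos (INR d)) as hed.
assert (ht0 : 0 <= t) by (rewrite ht; apply Rmult_le_pos; lra).
assert (hq : 0 <= 1 - u <= exp (- u)) by (pose proof (exp_ineq1_le (- u)); lra).
assert (hpow : (1 - u) ^ m <= exp (- u) ^ m) by (apply pow_incr; lra).
assert (hpow0 : 0 <= (1 - u) ^ m) by (apply pow_le; lra).
assert (he : forall k, exp (- u) ^ k = exp (- (INR k * u))).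
{ intros k; induction k as [|k IH]; [simpl; rewrite Rmult_0_l, Ropp_0, exp_0; reflexivity|].
  rewrite S_INR; simpl; rewrite IH, <- exp_plus; f_equal; ring. }
assert (hm1 : exp (- u) ^ m <= exp (INR d) * exp (- t)).
{ rewrite he, <- exp_plus. apply exp_mono. rewrite ht, hdn. nra. }
(* the three successive errors: prefactor, (1-u)^m against e^(-mu), e^(-mu) against e^(-nu) *)
assert (e1 : Rabs (rho * (1 - u) ^ m - (1 - u) ^ m) <= INR d ^ 2 / INR n * (exp (INR d) * exp (- t))).
{ replace (rho * (1 - u) ^ m - (1 - u) ^ m) with (- ((1 - rho) * (1 - u) ^ m)) by ring.
  rewrite Rabs_Ropp, Rabs_pos_eq by (apply Rmult_le_pos; lra).
  apply Rmult_le_compat; lra. }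
assert (e2 : Rabs ((1 - u) ^ m - exp (- u) ^ m) <= / INR n * (t ^ 2 * (exp (INR d + 1) * exp (- t)))).
{ rewrite Rabs_minus_sym, Rabs_pos_eq by lra.
  destruct m as [|m]; [lia|].
  eapply Rle_trans; [apply pow_diff_bounds; lra|].
  assert (hu2 : exp (- u) - (1 - u) <= u ^ 2).
  { pose proof (exp_ineq1_le u) as hu1. rewrite exp_Ropp.
    assert (/ exp u <= / (1 + u)) by (apply Rinv_le_contravar; lra).
    assert (/ (1 + u) <= 1 - u + u ^ 2).
    { apply Rmult_le_reg_l with (1 + u); [lra|]. rewrite Rinv_r by lra.
      assert (0 <= u ^ 3) by (apply pow_le; lra). nra. }
    lra. }
  assert (hem : exp (- u) ^ m <= exp (INR d + 1) * exp (- t)).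
  { rewrite he, <- exp_plus. apply exp_mono. rewrite ht, hdn, S_INR. nra. }
  assert (hem0 : 0 <= exp (- u) ^ m) by (apply pow_le; left; apply exp_pos).
  rewrite <- Rmult_assoc.
  apply Rmult_le_compat; [|exact hem0| |exact hem].
  - apply Rmult_le_pos; lra.
  - rewrite ht. apply Rle_trans with (INR (S m) * u ^ 2).
    + apply Rmult_le_compat_l; lra.
    + replace (/ INR n * (INR n * u) ^ 2) with (INR n * u ^ 2) by (field; lra).
      apply Rmult_le_compat_r; [apply pow2_ge_0|lra]. }
assert (e3 : Rabs (exp (- u) ^ m - exp (- t)) <= / INR n * (t * (INR d * exp (INR d) * exp (- t)))).
{ rewrite he. replace (- (INR m * u)) with (INR d * u + - t) by (rewrite ht, hdn; ring).
  rewrite exp_plus.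
  assert (hdu : 0 <= INR d * u) by (apply Rmult_le_pos; lra).
  assert (h1 : 1 <= exp (INR d * u)) by (rewrite <- exp_0; apply exp_mono; exact hdu).
  assert (h2 : exp (INR d * u) - 1 <= INR d * u * exp (INR d)).
  { pose proof (exp_ineq1_le (- (INR d * u))) as h3. rewrite exp_Ropp in h3.
    assert (exp (INR d * u) * (1 + - (INR d * u)) <= 1).
    { apply Rle_trans with (exp (INR d * u) * / exp (INR d * u)); [apply Rmult_le_compat_l; lra|].
      rewrite Rinv_r; lra. }
    assert (exp (INR d * u) <= exp (INR d)) by (apply exp_mono; nra).
    assert (INR d * u * exp (INR d * u) <= INR d * u * exp (INR d)) by (apply Rmult_le_compat_l; lra). lra. }
  replace (exp (INR d * u) * exp (- t) - exp (- t)) with ((exp (INR d * u) - 1) * exp (- t)) by ring.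
  rewrite Rabs_pos_eq by (apply Rmult_le_pos; lra).
  replace (/ INR n * (t * (INR d * exp (INR d) * exp (- t)))) with (INR d * u * exp (INR d) * exp (- t)).
  - apply Rmult_le_compat_r; lra.
  - rewrite ht; field; lra. }
replace (rho * (1 - u) ^ m - exp (- t)) with
  ((rho * (1 - u) ^ m - (1 - u) ^ m) + (((1 - u) ^ m - exp (- u) ^ m) + (exp (- u) ^ m - exp (- t)))) by ring.
eapply Rle_trans; [apply Rabs_triang|].
eapply Rle_trans; [apply Rplus_le_compat; [exact e1|eapply Rle_trans; [apply Rabs_triang|apply Rplus_le_compat; [exact e2|exact e3]]]|].
pose proof (exp_pos (INR d + 1)) as hed1.
set (p := / INR n * exp (- t)).
assert (hp : 0 <= p) by (unfold p; apply Rmult_le_pos; lra).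
replace (INR d ^ 2 / INR n * (exp (INR d) * exp (- t)) +
  (/ INR n * (t ^ 2 * (exp (INR d + 1) * exp (- t))) + / INR n * (t * (INR d * exp (INR d) * exp (- t)))))
 with (p * (INR d ^ 2 * exp (INR d) * 1 + exp (INR d + 1) * t ^ 2 + INR d * exp (INR d) * t)) by (unfold p; field; lra).
replace ((INR d ^ 2 * exp (INR d) + exp (INR d + 1) + INR d * exp (INR d)) / INR n * ((1 + t) ^ 2 * exp (- t)))
 with (p * (INR d ^ 2 * exp (INR d) * (1 + t) ^ 2 + exp (INR d + 1) * (1 + t) ^ 2 + INR d * exp (INR d) * (1 + t) ^ 2)) by (unfold p; field; lra).
apply Rmult_le_compat_l; [exact hp|].
pose proof (pow2_ge_0 (INR d)). pose proof (pow2_ge_0 t).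
repeat apply Rplus_le_compat; apply Rmult_le_compat_l; nra.
Qed.

Lemma power_exp_vanishes D s c : 0 < s -> 0 <= c ->
  is_lim_seq (fun k => (c - - INR k) ^ D * exp (s * (- INR k - c))) (Finite 0).
Proof.
intros hs hc. destruct (pow_le_exp (S D) s hs) as [C [hC h]].
apply is_lim_seq_incr_1.
apply (is_lim_seq_rate (fun k => (c - - INR k) ^ D * exp (s * (- INR k - c))) 0 C).
intros k hk; apply INR_gt0 in hk. rewrite Rminus_0_r.
replace (c - - INR k) with (c + INR k) by ring.
specialize (h (c + INR k) ltac:(lra)).
replace (s * (- INR k - c)) with (- (s * (c + INR k))) by ring. rewrite exp_Ropp.
pose proof (exp_pos (s * (c + INR k))) as he.
assert (hp : 0 <= (c + INR k) ^ D) by (apply pow_le; lra).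
rewrite Rabs_pos_eq by (apply Rmult_le_pos; [lra|left; apply Rinv_0_lt_compat; lra]).
apply Rle_trans with (C / (c + INR k)).
- apply -> Rle_div_r; [|lra]. replace ((c + INR k) ^ D * / exp (s * (c + INR k)) * (c + INR k))
    with ((c + INR k) ^ S D / exp (s * (c + INR k))) by (simpl; field; lra).
  apply Rle_div_l; lra.
- apply Rmult_le_compat_l; [lra|]. apply Rinv_le_contravar; lra.
Qed.

(** The Gamma(d) density enters here: with D = d - 1 and s = d + i the value is (d-1)!/(d+i)^d, so
    every term of the exact finite sum becomes an integral over the same half line. *)
Lemma power_exp_integral D s c : 0 < s -> 0 <= c ->
  is_lim_seq (fun k => RInt (fun v => (c - v) ^ D * exp (s * (v - c))) (- INR k) c)
    (Finite (INR (fact D) * (/ s) ^ S D)).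
Proof.
intros hs hc.
assert (hcont : forall D v, continuous (fun v => (c - v) ^ D * exp (s * (v - c))) v).
{ intros D' v; apply (ex_derive_continuous (fun v => (c - v) ^ D' * exp (s * (v - c)))). auto_derive; auto. }
assert (hex : forall D x y, ex_RInt (fun v => (c - v) ^ D * exp (s * (v - c))) x y).
{ intros; apply @ex_RInt_continuous; intros; apply hcont. }
induction D as [|D IH].
- apply is_lim_seq_ext with (fun k => 1 / s - / s * ((c - - INR k) ^ 0 * exp (s * (- INR k - c)))).
  + intros k. symmetry. apply is_RInt_unique.
    replace (1 / s - / s * ((c - - INR k) ^ 0 * exp (s * (- INR k - c))))
      with (minus (exp (s * (c - c)) / s) (exp (s * (- INR k - c)) / s)).
    2:{ rewrite Rminus_diag, Rmult_0_r, exp_0. unfold minus, plus, opp; simpl; field; lra. }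
    apply (is_RInt_derive (fun v => exp (s * (v - c)) / s)).
    * intros v _. auto_derive; [auto|]. simpl; unfold Rdiv, Rminus; field; lra.
    * intros v _. apply hcont.
  + replace (INR (fact 0) * (/ s) ^ 1) with (1 / s - / s * 0) by (simpl; field; lra).
    apply is_lim_seq_minus'; [apply is_lim_seq_const|].
    apply is_lim_seq_mult'; [apply is_lim_seq_const|apply power_exp_vanishes; assumption].
- apply is_lim_seq_ext with (fun k => INR (S D) / s * RInt (fun v => (c - v) ^ D * exp (s * (v - c))) (- INR k) c
     - / s * ((c - - INR k) ^ S D * exp (s * (- INR k - c)))).
  + intros k.
    (* Integration by parts, stated as the integral of the derivative of one product, which vanishes
       at the upper end [c]. *)
    assert (h : RInt (fun v => (c - v) ^ S D * exp (s * (v - c)) + - (INR (S D) / s) * ((c - v) ^ D * exp (s * (v - c)))) (- INR k) c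
       = - (/ s * ((c - - INR k) ^ S D * exp (s * (- INR k - c))))).
    { apply is_RInt_unique.
      replace (- (/ s * ((c - - INR k) ^ S D * exp (s * (- INR k - c)))))
        with (minus (/ s * ((c - c) ^ S D * exp (s * (c - c)))) (/ s * ((c - - INR k) ^ S D * exp (s * (- INR k - c))))).
      2:{ rewrite Rminus_diag, pow_i by lia. unfold minus, plus, opp; simpl; ring. }
      apply (is_RInt_derive (fun v => / s * ((c - v) ^ S D * exp (s * (v - c))))).
      - intros v _. auto_derive; [auto|]. rewrite S_INR. simpl pow. simpl pred. unfold Rminus.
        destruct D; [simpl|rewrite S_INR]; field; lra.
      - intros v _. apply (ex_derive_continuous (fun v => (c - v) ^ S D * exp (s * (v - c)) + - (INR (S D) / s) * ((c - v) ^ D * exp (s * (v - c))))).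
        auto_derive; auto. }
    assert (hsplit : RInt (fun v => (c - v) ^ S D * exp (s * (v - c)) + - (INR (S D) / s) * ((c - v) ^ D * exp (s * (v - c)))) (- INR k) c
      = RInt (fun v => (c - v) ^ S D * exp (s * (v - c))) (- INR k) c + - (INR (S D) / s) * RInt (fun v => (c - v) ^ D * exp (s * (v - c))) (- INR k) c).
    { rewrite <- (RInt_scal (fun v => (c - v) ^ D * exp (s * (v - c)))) by apply hex.
      apply (RInt_plus (fun v => (c - v) ^ S D * exp (s * (v - c))) (fun v => - (INR (S D) / s) * ((c - v) ^ D * exp (s * (v - c))))); [apply hex|].
      apply (ex_RInt_scal (fun v => (c - v) ^ D * exp (s * (v - c)))), hex. }
    lra.
  + replace (INR (fact (S D)) * (/ s) ^ S (S D)) with (INR (S D) / s * (INR (fact D) * (/ s) ^ S D) - / s * 0).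
    2:{ rewrite fact_simpl, mult_INR. cbn [pow]. field; lra. }
    apply is_lim_seq_minus'.
    * apply is_lim_seq_mult'; [apply is_lim_seq_const|exact IH].
    * apply is_lim_seq_mult'; [apply is_lim_seq_const|apply power_exp_vanishes; assumption].
Qed.

Lemma binomial_rsum n x y : (x + y) ^ n = rsum (S n) (fun i => Binomial.C n i * x ^ i * y ^ (n - i)).
Proof.
rewrite binomial. generalize (fun i => Binomial.C n i * x ^ i * y ^ (n - i)) as f.
intros f; induction n as [|n IH]; [simpl; ring|]. cbn [sum_f_R0 rsum] in *. rewrite IH; reflexivity.
Qed.

Lemma MInt_interior_generators d n : exists v, MInt (d * n) (num_interior_generators d n) v /\
  is_lim_seq (fun N => gsum (S N) (d * n) (num_interior_generators d n)) (Finite v).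
Proof.
destruct (MInt_grid_approx (d * n) 2 (INR n ^ d)) as [K [_ h]]; [apply pow_le, pos_INR|].
destruct (h (0 :: 1 :: nil) (num_interior_generators d n)) as [v [hv hN]].
- reflexivity.
- apply num_interior_generators_invariant.
- intros w; apply GridCount.num_interior_generators_bounded.
- exists v; split; [exact hv|].
  apply (is_lim_seq_rate (fun N => gsum N (d * n) (num_interior_generators d n)) v K).
  intros N h0; rewrite Rabs_minus_sym; apply hN, h0.
Qed.

(* The expected number of interior generators, times [(d-1)!], as an integral over [(- oo, ln n)]
   after the substitution [prod_j (1 - x_j) = e^v / n]. *)
Lemma generators_line_limit d n m v : (1 <= d)%nat -> n = (m + d)%nat ->
  is_lim_seq (fun N => gsum (S N) (d * n) (num_interior_generators d n)) (Finite v) ->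
  is_lim_seq (fun k => RInt (fun u => falling n d / INR n ^ d * (1 - exp u / INR n) ^ m *
      ((ln (INR n) - u) ^ (d - 1) * exp (INR d * u))) (- INR k) (ln (INR n)))
    (Finite (INR (fact (d - 1)) * v)).
Proof.
intros hd hn hv.
assert (hn1 : 1 <= INR n) by (apply (le_INR 1); lia).
set (c := ln (INR n)).
assert (hc : 0 <= c) by (unfold c; rewrite <- ln_1; apply ln_le; lra).
assert (hec : exp c = INR n) by (apply exp_ln; lra).
set (b := fun i => Binomial.C m i * (-1) ^ i).
assert (hb : forall y, (1 - y) ^ m = rsum (S m) (fun i => b i * y ^ i)).
{ intros y. replace (1 - y) with (- 1 * y + 1) by ring. rewrite binomial_rsum.
  apply rsum_ext; intros i _. unfold b. rewrite pow1, Rpow_mult_distr. ring. }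
assert (hval : v = falling n d * rsum (S m) (fun i => b i * (/ INR (d + i)) ^ d)).
{ pose proof (generators_grid_limit d m b hd hb) as hl.
  replace (d + m)%nat with n in hl by lia.
  apply is_lim_seq_unique in hl. apply is_lim_seq_unique in hv. rewrite hv in hl. injection hl; auto. }
set (f := fun i u => (c - u) ^ (d - 1) * exp (INR (d + i) * (u - c))).
assert (hcont : forall i u, continuous (f i) u).
{ intros i u; apply (ex_derive_continuous (f i)). unfold f; auto_derive; auto. }
assert (hint : forall M k, RInt (fun u => rsum M (fun i => b i * f i u)) (- INR k) c
    = rsum M (fun i => b i * RInt (f i) (- INR k) c)).
{ intros M k; induction M as [|M IH]; simpl.
  - rewrite RInt_const. unfold scal; simpl; unfold mult; simpl; ring.
  - rewrite <- IH.
    rewrite <- (RInt_scal (f M)) by (apply @ex_RInt_continuous; intros; apply hcont).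
    apply (RInt_plus (fun u => rsum M (fun i => b i * f i u)) (fun u => b M * f M u)).
    + apply @ex_RInt_continuous; intros z _. apply continuous_rsum; intros i.
      apply (continuous_scal_r (b i) (f i)), hcont.
    + apply (ex_RInt_scal (f M)), @ex_RInt_continuous; intros; apply hcont. }
(* Each term of the closed form is read as an integral, and the sum of the integrands is folded back
   into (1 - e^u/n)^m, where the alternating signs no longer hurt. *)
apply is_lim_seq_ext with (fun k => falling n d * rsum (S m) (fun i => b i * RInt (f i) (- INR k) c)).
- intros k. rewrite <- hint.
  rewrite <- (RInt_scal (fun u => rsum (S m) (fun i => b i * f i u))).
  2:{ apply @ex_RInt_continuous; intros z _. apply continuous_rsum; intros i.
      apply (continuous_scal_r (b i) (f i)), hcont. }
  apply RInt_ext; intros u _. rewrite hb. unfold scal; simpl scal; unfold mult; simpl mult.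
  match goal with |- ?L = ?R0 => change (falling n d * rsum (S m) (fun i => b i * f i u) = R0) end.
  replace (falling n d / INR n ^ d * rsum (S m) (fun i => b i * (exp u / INR n) ^ i) * ((c - u) ^ (d - 1) * exp (INR d * u)))
    with (falling n d * ((c - u) ^ (d - 1) * (exp (INR d * u) / INR n ^ d) * rsum (S m) (fun i => b i * (exp u / INR n) ^ i))).
  2:{ field. apply pow_nonzero; lra. }
  f_equal. rewrite <- rsum_scal. apply rsum_ext; intros i _. unfold f.
  assert (hpow : forall j, exp (INR j * (u - c)) = (exp u / INR n) ^ j).
  { intros j; induction j as [|j IHj]; [simpl; rewrite Rmult_0_l; apply exp_0|].
    rewrite S_INR, Rmult_plus_distr_r, exp_plus, IHj, Rmult_1_l. simpl.
    unfold Rminus at 1. rewrite exp_plus, exp_Ropp, hec. unfold Rdiv; ring. }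
  assert (hd' : exp (INR d * u) / INR n ^ d = exp (INR d * (u - c))).
  { replace (INR d * (u - c)) with (INR d * u + - (INR d * c)) by ring.
    rewrite exp_plus, exp_Ropp. unfold Rdiv; do 2 f_equal. clear -hec.
    induction d as [|j IHj]; [simpl; rewrite Rmult_0_l, exp_0; reflexivity|].
    rewrite S_INR, Rmult_plus_distr_r, exp_plus, <- IHj, Rmult_1_l, hec; simpl; ring. }
  rewrite hd', <- hpow, plus_INR, Rmult_plus_distr_r, exp_plus. ring.
- replace (INR (fact (d - 1)) * v)
    with (falling n d * rsum (S m) (fun i => b i * (INR (fact (d - 1)) * (/ INR (d + i)) ^ S (d - 1)))).
  2:{ rewrite hval. replace (S (d - 1)) with d by lia.
      rewrite (rsum_ext _ _ (fun i => INR (fact (d - 1)) * (b i * (/ INR (d + i)) ^ d))) by (intros; ring).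
      rewrite rsum_scal. ring. }
  apply is_lim_seq_mult'; [apply is_lim_seq_const|].
  apply (is_lim_seq_rsum (S m) (fun i k => b i * RInt (f i) (- INR k) c)).
  intros i. apply is_lim_seq_mult'; [apply is_lim_seq_const|].
  apply power_exp_integral; [apply INR_gt0; lia|exact hc].
Qed.

Lemma main_term_line_int G D x c : (forall j x, 0 < x -> line_int (gamma_integrand j x) (G j x)) -> 0 < x ->
  line_int (fun v => (c - v) ^ D * exp (x * v - exp v))
    (rsum (S D) (fun j => Binomial.C D j * (-1) ^ j * c ^ (D - j) * G j x)).
Proof.
intros hG hx. unfold line_int.
apply is_lim_seq_ext with (fun k => RInt (fun v => rsum (S D) (fun j => Binomial.C D j * (-1) ^ j * c ^ (D - j) * gamma_integrand j x v)) (- INR k) (INR k)).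
- intros k. apply RInt_ext; intros v _.
  replace (c - v) with (-1 * v + c) by ring. rewrite binomial_rsum, Rmult_comm, <- rsum_scal.
  apply rsum_ext; intros j _. unfold gamma_integrand. rewrite Rpow_mult_distr. ring.
- apply (line_int_rsum (S D) (fun j v => Binomial.C D j * (-1) ^ j * c ^ (D - j) * gamma_integrand j x v)).
  + intros i v. apply (continuous_scal_r _ (gamma_integrand i x)), gamma_integrand_continuous.
  + intros i. apply line_int_scal; [intros; apply gamma_integrand_continuous|apply hG, hx].
Qed.

(** The exact integrand stops at ln n while the Gamma moments run over the whole line. One majorant
    handles both the difference to the left of ln n and the discarded tail to its right; [W] is
    independent of n, so n enters the bound only through (ln n)^(d-1)/n. *)
Lemma line_limit_comparison G d : (1 <= d)%nat ->
  (forall j x, 0 < x -> line_int (gamma_integrand j x) (G j x)) ->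
  exists K, forall n v, (3 + d <= n)%nat ->
  is_lim_seq (fun N => gsum (S N) (d * n) (num_interior_generators d n)) (Finite v) ->
  Rabs (INR (fact (d - 1)) * v -
        rsum (S (d - 1)) (fun j => Binomial.C (d - 1) j * (-1) ^ j * ln (INR n) ^ (d - 1 - j) * G j (INR d)))
  <= K * (ln (INR n) ^ (d - 1) / INR n).
Proof.
intros hd hG.
pose proof (INR_gt0 d ltac:(lia)) as hd0.
set (W := fun v => (1 + Rabs v) ^ (d - 1) * ((1 + exp v) ^ 2 * exp (INR d * v - exp v))).
assert (hW : dominated W).
{ apply dominated_mult_pow.
  apply dominated_le with (fun v => exp (INR d * v - exp v) + (exp ((INR d + 1) * v - exp v) +
     (exp ((INR d + 1) * v - exp v) + exp ((INR d + 2) * v - exp v)))).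
  - repeat apply dominated_plus; apply dominated_exp_exp; lra.
  - intros v. right. f_equal.
    replace ((INR d + 1) * v - exp v) with (v + (INR d * v - exp v)) by ring.
    replace ((INR d + 2) * v - exp v) with (v + (v + (INR d * v - exp v))) by ring.
    rewrite !(exp_plus v). ring. }
destruct hW as [C [a [ha hW]]].
assert (hC : 0 <= C).
{ specialize (hW 0). pose proof (Rabs_pos (W 0)). pose proof (exp_pos (- (a * Rabs 0))). nra. }
set (K := INR d ^ 2 * exp (INR d) + exp (INR d + 1) + INR d * exp (INR d)).
assert (hK : 1 <= K).
{ unfold K. pose proof (exp_ineq1_le (INR d + 1)). pose proof (exp_pos (INR d)).
  pose proof (pow2_ge_0 (INR d)). nra. }
exists (4 * (K * C) / a). intros n v hn hv.
assert (hn3 : 3 <= INR n) by (replace 3 with (INR 3) by (simpl; lra); apply le_INR; lia).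
set (c := ln (INR n)).
assert (hec : exp c = INR n) by (apply exp_ln; lra).
(* n >= 3 >= e gives c >= 1, which is what turns |c - u| <= c + |u| into |c - u| <= c (1 + |u|). *)
assert (hc : 1 <= c).
{ unfold c. rewrite <- (ln_exp 1). apply ln_le; [apply exp_pos|]. pose proof exp_le_3; lra. }
destruct (Nat.le_exists_sub d n) as [m [hm _]]; [lia|].
set (psi := fun u => falling n d / INR n ^ d * (1 - exp u / INR n) ^ m * ((c - u) ^ (d - 1) * exp (INR d * u))).
set (chi := fun u => (c - u) ^ (d - 1) * exp (INR d * u - exp u)).
pose proof (generators_line_limit d n m v hd hm hv) as hpsi. fold c psi in hpsi.
pose proof (main_term_line_int G (d - 1) (INR d) c hG hd0) as hchi. unfold line_int in hchi. fold chi in hchi.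
set (E := K * c ^ (d - 1) / INR n * C).
assert (hcd : 0 <= c ^ (d - 1)) by (apply pow_le; lra).
assert (hE0 : 0 <= K * c ^ (d - 1) / INR n).
{ apply Rmult_le_pos; [apply Rmult_le_pos; lra|left; apply Rinv_0_lt_compat; lra]. }
assert (hE : 0 <= E) by (apply Rmult_le_pos; assumption).
assert (hcv : forall u, Rabs ((c - u) ^ (d - 1)) <= c ^ (d - 1) * (1 + Rabs u) ^ (d - 1)).
{ intros u. rewrite <- RPow_abs, <- Rpow_mult_distr. apply pow_incr; split; [apply Rabs_pos|].
  pose proof (Rabs_pos u). eapply Rle_trans; [apply Rabs_triang|]. rewrite Rabs_Ropp, (Rabs_pos_eq c) by lra. nra. }
assert (hWE : forall u y, Rabs y <= K * c ^ (d - 1) / INR n * W u -> Rabs y <= E * exp (- (a * Rabs u))).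
{ intros u y hy. eapply Rle_trans; [exact hy|]. unfold E. rewrite Rmult_assoc.
  apply Rmult_le_compat_l; [exact hE0|]. eapply Rle_trans; [apply Rle_abs|apply hW]. }
assert (hleft : forall u, u <= c -> Rabs (psi u - chi u) <= E * exp (- (a * Rabs u))).
{ intros u hu. apply hWE.
  assert (heu : 0 < exp u <= INR n) by (split; [apply exp_pos|rewrite <- hec; apply exp_mono, hu]).
  assert (hk := binomial_kernel_approx n m d (exp u / INR n) (falling n d / INR n ^ d) (exp u) hm ltac:(lia)).
  assert (hk' : Rabs (falling n d / INR n ^ d * (1 - exp u / INR n) ^ m - exp (- exp u)) <=
      K / INR n * ((1 + exp u) ^ 2 * exp (- exp u))).
  { apply hk.
    - split; [apply Rmult_le_pos; [lra|left; apply Rinv_0_lt_compat; lra]|apply Rle_div_l; lra].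
    - field; lra.
    - apply falling_ratio; lia. }
  replace (psi u - chi u) with ((falling n d / INR n ^ d * (1 - exp u / INR n) ^ m - exp (- exp u)) * ((c - u) ^ (d - 1) * exp (INR d * u))).
  2:{ unfold psi, chi, Rminus. rewrite exp_plus. ring. }
  rewrite !Rabs_mult, (Rabs_pos_eq (exp _)) by (left; apply exp_pos).
  replace (K * c ^ (d - 1) / INR n * W u) with
    (K / INR n * ((1 + exp u) ^ 2 * exp (- exp u)) * (c ^ (d - 1) * (1 + Rabs u) ^ (d - 1) * exp (INR d * u))).
  2:{ unfold W, Rminus, Rdiv. rewrite exp_plus. ring. }
  apply Rmult_le_compat; [apply Rabs_pos| |exact hk'|].
  - apply Rmult_le_pos; [apply Rabs_pos|left; apply exp_pos].
  - apply Rmult_le_compat_r; [left; apply exp_pos|apply hcv]. }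
assert (hright : forall u, c <= u -> Rabs (chi u) <= E * exp (- (a * Rabs u))).
{ intros u hu. apply hWE. unfold chi. rewrite Rabs_mult, (Rabs_pos_eq (exp _)) by (left; apply exp_pos).
  assert (heu : INR n <= exp u) by (rewrite <- hec; apply exp_mono, hu).
  pose proof (exp_pos (INR d * u - exp u)) as he.
  (* Beyond ln n the factor (1 + e^u)^2 exceeds n, so the majorant of the relative error is at least
     1 and covers the main term itself. *)
  assert (h1 : 1 <= K / INR n * (1 + exp u) ^ 2).
  { apply Rle_trans with (1 / INR n * INR n); [right; field; lra|].
    apply Rmult_le_compat; try lra.
    - left; apply Rdiv_lt_0_compat; lra.
    - apply Rmult_le_compat_r; [left; apply Rinv_0_lt_compat|]; lra.
    - nra. }
  replace (K * c ^ (d - 1) / INR n * W u) with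
    ((c ^ (d - 1) * (1 + Rabs u) ^ (d - 1)) * ((K / INR n * (1 + exp u) ^ 2) * exp (INR d * u - exp u))).
  2:{ unfold W, Rdiv. ring. }
  apply Rmult_le_compat; [apply Rabs_pos|lra|apply hcv|]. nra. }
assert (hpc : forall u, continuous psi u).
{ intros u; apply (ex_derive_continuous psi). unfold psi; auto_derive; auto. }
assert (hcc : forall u, continuous chi u).
{ intros u; apply (ex_derive_continuous chi). unfold chi; auto_derive; auto. }
replace (4 * (K * C) / a * (c ^ (d - 1) / INR n)) with (4 * E / a) by (unfold E; field; lra).
apply (is_lim_seq_le_loc (fun k => Rabs (RInt psi (- INR k) c - RInt chi (- INR k) (INR k))) (fun _ => 4 * E / a)
  (Finite (Rabs (INR (fact (d - 1)) * v - rsum (S (d - 1)) (fun j => Binomial.C (d - 1) j * (-1) ^ j * c ^ (d - 1 - j) * G j (INR d)))))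
  (Finite (4 * E / a))).
- destruct (nfloor_ex c) as [k0 hk0]; [lra|]. exists (S k0); intros k hk.
  apply le_INR in hk. rewrite S_INR in hk.
  assert (hex : forall x y, ex_RInt chi x y) by (intros; apply @ex_RInt_continuous; intros; apply hcc).
  assert (e1 : RInt chi (- INR k) (INR k) = RInt chi (- INR k) c + RInt chi c (INR k)).
  { symmetry; apply (RInt_Chasles chi); apply hex. }
  assert (e2 : RInt (fun u => psi u - chi u) (- INR k) c = RInt psi (- INR k) c - RInt chi (- INR k) c).
  { apply (RInt_minus psi chi); [apply @ex_RInt_continuous; intros; apply hpc|apply hex]. }
  replace (RInt psi (- INR k) c - RInt chi (- INR k) (INR k))
    with (RInt (fun u => psi u - chi u) (- INR k) c - RInt chi c (INR k)) by (rewrite e1, e2; ring).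
  (* Both estimates are increments of the same [logistic a], over adjacent intervals, and telescope
     to its increment over the whole window. *)
  assert (b1 := RInt_exp_abs_bound (fun u => psi u - chi u) E a (- INR k) c ha ltac:(lra)
    (fun u => continuous_minus psi chi u (hpc u) (hcc u)) (fun u hu => hleft u (proj2 hu))).
  assert (b2 := RInt_exp_abs_bound chi E a c (INR k) ha ltac:(lra) hcc (fun u hu => hright u (proj1 hu))).
  pose proof (logistic_increment a (- INR k) (INR k) ha) as b3.
  apply (Rmult_le_compat_l (4 * E)) in b3; [|lra].
  unfold Rminus at 1. eapply Rle_trans; [apply Rabs_triang|]. rewrite Rabs_Ropp. unfold Rdiv. lra.
- apply (is_lim_seq_abs _ (Finite _)). apply is_lim_seq_minus'; assumption.
- apply is_lim_seq_const.
Qed.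

Theorem theoremT (d : nat) (hd : (1 <= d)%nat) :
  exists I : nat -> R,
    (forall n : nat, MInt (d * n) (num_interior_generators d n) (I n)) /\
    forall (Gam : R -> R) (D : nat -> R -> R),
      (forall x, 0 < x -> is_Gamma x (Gam x)) ->
      are_derivs_on_pos Gam D ->
      exists C : R, exists N : nat, forall n : nat, (N <= n)%nat ->
        Rabs (I n -
              ln (INR n) ^ (d - 1) *
              sum_f_R0 (fun j => (-1) ^ j * D j (INR d)
                                 / (INR (fact j) * INR (fact (d - 1 - j)))
                                 / ln (INR n) ^ j) (d - 1))
        <= C * (ln (INR n) ^ (d - 1) / INR n).
Proof.
destruct (choice _ (MInt_interior_generators d)) as [I hI].
exists I; split; [intros n; apply hI|].
intros Gam D hGam hD.
destruct gamma_moments_ex as [G hG].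
destruct (line_limit_comparison G d hd hG) as [K hK].
assert (hf : 0 < INR (fact (d - 1))) by apply INR_fact_lt_0.
exists (K / INR (fact (d - 1))), (3 + d)%nat. intros n hn.
specialize (hK n (I n) hn (proj2 (hI n))).
assert (hn3 : 3 <= INR n) by (replace 3 with (INR 3) by (simpl; lra); apply le_INR; lia).
assert (hc : 0 < ln (INR n)) by (rewrite <- ln_1; apply ln_increasing; lra).
set (c := ln (INR n)) in *.
assert (hsum : forall f k, sum_f_R0 f k = rsum (S k) f).
{ intros f k; induction k as [|k IH]; [simpl; ring|]. cbn [sum_f_R0 rsum] in *; rewrite IH; reflexivity. }
rewrite hsum.
assert (hmain : INR (fact (d - 1)) * (c ^ (d - 1) * rsum (S (d - 1)) (fun j => (-1) ^ j * D j (INR d)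
                                 / (INR (fact j) * INR (fact (d - 1 - j))) / c ^ j))
  = rsum (S (d - 1)) (fun j => Binomial.C (d - 1) j * (-1) ^ j * c ^ (d - 1 - j) * G j (INR d))).
{ rewrite <- !rsum_scal. apply rsum_ext; intros j hj.
  rewrite (derivs_are_gamma_moments Gam D G hGam hD hG) by (apply INR_gt0; lia).
  replace (c ^ (d - 1)) with (c ^ (d - 1 - j) * c ^ j) by (rewrite <- pow_add; f_equal; lia).
  unfold Binomial.C. field. repeat split; try apply INR_fact_neq_0. apply pow_nonzero; lra. }
rewrite <- hmain, <- Rmult_minus_distr_l, Rabs_mult, Rabs_pos_eq in hK by lra.
replace (K / INR (fact (d - 1)) * (c ^ (d - 1) / INR n)) with (/ INR (fact (d - 1)) * (K * (c ^ (d - 1) / INR n))) by (field; lra).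
apply (Rmult_le_compat_l (/ INR (fact (d - 1)))) in hK; [|left; apply Rinv_0_lt_compat; lra].
rewrite <- Rmult_assoc, Rinv_l, Rmult_1_l in hK by lra. exact hK.
Qed.
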